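(* Let $r^*\in [m]\cup\{0\}$, $r\in [m]$, $\infty>L\geq \mu>0$ and $\kappa:=\frac{L}{\mu}\geq 1$. Suppose that $r^*$, $r$ and $\kappa$ satisfy any of the following conditions: (1) $r=m$; (2) $r\geq r^*$ and $\min\{r,m-r^*\}>\frac{(\kappa-1)^2}{4}\min\{r^*,m-r\}$. Then for all $h\in\mathfrak{S}(L,\mu,r^* )$, the corresponding function $f(X)=h(X)+\lambda\|X\|_*$ is $r$-factorizable. Otherwise (i.e. if neither (1) nor (2) holds), there exists a quadratic $h\in\mathfrak{S}(L,\mu,r^* )$ such that the corresponding $f=h+\lambda\|\cdot\|_*$ is not $r$-factorizable.
   Context: Throughout, $1\le m\le n$ are integers, $\lambda>0$ is a fixed constant, and $[k]:=\{1,\dots,k\}$, $[0]:=\emptyset$. $\|\cdot\|_*$ is the nuclear norm and $\|\cdot\|_F$ the Frobenius norm. For a twice continuously differentiable $h:\mathbb{R}^{m\times n}\to\mathbb{R}$ and $r\in[m]$, put $f(X):=h(X)+\lambda\|X\|_*$ for $X\in\mathbb{R}^{m\times n}$ and $F_r(U,V):=h(UV^\top)+\frac{\lambda}{2}(\|U\|_F^2+\|V\|_F^2)$ for $(U,V)\in\mathbb{R}^{m\times r}\times\mathbb{R}^{n\times r}$. A second-order stationary point of $F_r$ is a point where the gradient of $F_r$ vanishes and the Hessian of $F_r$ is positive semidefinite. The function $f$ is called $r$-factorizable if every second-order stationary point $(U,V)$ of $F_r$ satisfies that $UV^\top$ is a global minimizer of $f$. $\mathfrak{S}(L,\mu,r^*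 )$ denotes the set of all $h\in C^2(\mathbb{R}^{m\times n})$ such that (i) $\mu\|H\|_F^2\le\nabla^2h(X)[H,H]\le L\|H\|_F^2$ for all $X,H\in\mathbb{R}^{m\times n}$ (i.e. $h$ is $\mu$-strongly convex and $\nabla h$ is $L$-Lipschitz with respect to the Frobenius norm), and (ii) there exists a global minimizer $X^*$ of $f=h+\lambda\|\cdot\|_*$ with $\mathrm{rank}(X^* )=r^*$. *)

(* Defs.v *)
From HB Require Import structures.
From mathcomp Require Export all_boot all_order all_algebra.
From mathcomp Require Export all_classical all_reals all_analysis.
From mathcomp.real_closed Require Export polyrcf.

Set Implicit Arguments.
Unset Strict Implicit.
Unset Printing Implicit Defensive.

Export Order.TTheory GRing.Theory Num.Theory.
Export numFieldNormedType.Exports.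

Local Open Scope classical_set_scope.
Local Open Scope ring_scope.

Section Norms.
Context {R : realType} {m n : nat}.
Implicit Type X : 'M[R]_(m, n).

(* The square roots of the m eigenvalues of X X^T, with multiplicity; when
   m <= n these are exactly the m = min(m, n) singular values of X. *)
Definition singular_values X : seq R :=
  let p := char_poly (X *m X^T) in
  flatten [seq nseq (mup a p) (Num.sqrt a) | a <- rootsR p].

Definition nuclear_norm X : R := \sum_(s <- singular_values X) s.

Definition frobenius_norm X : R := Num.sqrt (\sum_i \sum_j X i j ^+ 2).

End Norms.

Section Calculus.
Context {R : realType}.

(* In finite dimension a function is C^2 iff it is differentiable, its
   first-order directional derivatives are differentiable, and its
   second-order directional derivatives are continuous. *)
Definition C2 {m n : nat} (h : 'M[R]_(m, n) -> R) : Prop :=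
  [/\ forall X, differentiable h X,
      forall H X, differentiable ('D_H h) X
    & forall H K, continuous ('D_K ('D_H h))].

(* The Hessian as a quadratic form, $\nabla^2 h(x)[H, H]$. *)
Definition hessian {V : normedModType R} (h : V -> R) (x H : V) : R :=
  'D_H ('D_H h) x.

(* The gradient is the Riesz representative of H |-> 'D_H F z, so it vanishes
   iff all directional derivatives do. *)
Definition second_order_stationary {V : normedModType R} (F : V -> R) (z : V)
    : Prop :=
  (forall H, 'D_H F z = 0) /\ (forall H, 0 <= hessian F z H).

Definition global_minimizer {T : Type} (f : T -> R) (x : T) : Prop :=
  forall y, f x <= f y.

(* Polynomials of degree at most 2 in the entries of X. *)
Definition quadratic {m n : nat} (h : 'M[R]_(m, n) -> R) : Prop :=
  exists (Q : 'M[R]_(m * n)) (B : 'M[R]_(m, n)) (c : R), forall X,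
    h X = (mxvec X *m Q *m (mxvec X)^T) 0 0 + \tr (B^T *m X) + c.

End Calculus.

Section Factorization.
Context {R : realType} {m n : nat}.
Implicit Types (lambda L mu : R) (h : 'M[R]_(m, n) -> R).

Definition regularized lambda h (X : 'M[R]_(m, n)) : R :=
  h X + lambda * nuclear_norm X.

Definition factored lambda h (r : nat) (UV : 'M[R]_(m, r) * 'M[R]_(n, r)) : R :=
  h (UV.1 *m UV.2^T) +
  lambda / 2 * (frobenius_norm UV.1 ^+ 2 + frobenius_norm UV.2 ^+ 2).

Definition factorizable lambda h (r : nat) : Prop :=
  forall (U : 'M[R]_(m, r)) (V : 'M[R]_(n, r)),
    second_order_stationary (@factored lambda h r) (U, V) ->
    global_minimizer (regularized lambda h) (U *m V^T).

(* The class S(L, mu, rs); it depends on lambda through the minimizer of f. *)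
Definition frakS lambda L mu (rs : nat) : set ('M[R]_(m, n) -> R) :=
  [set h | [/\ C2 h,
      forall X H, mu * frobenius_norm H ^+ 2 <= hessian h X H
                  <= L * frobenius_norm H ^+ 2
    & exists2 X, global_minimizer (regularized lambda h) X & \rank X = rs]].

End Factorization.

(* Main.v *)
Require Import Defs.
From mathcomp Require Import ring lra zify.

Set Implicit Arguments.
Unset Strict Implicit.
Unset Printing Implicit Defensive.

Local Open Scope classical_set_scope.
Local Open Scope ring_scope.

(** Put Z = - gradient h X and kappa = L / mu, let f be the regularized
    function, and let primes mark the corresponding objects at a minimizer X'
    of f of rank rs.

    Sufficiency.  Stationarity of (U, V) says Z V = lambda U and
    Z^T U = lambda V.  This forces X = U V^T and Z to share singular vectors,
    with Z having singular value lambda wherever X has a positive one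
    (balanced_joint_svd); the optimality of X' gives the same structure at X'
    with, in addition, all singular values of Z' at most lambda
    (minimizer_joint_svd).  By convexity X minimizes f as soon as all singular
    values of Z are at most lambda, so suppose that one exceeds lambda.  Testing
    the Hessian in directions made of singular vectors shows that U has rank r
    (rank_deficient_optimality) and that every singular value g of Z off the
    range of X satisfies g <= lambda + L s for every positive singular value s
    of X (cross_direction_bound).  If r = m, then X has full rank, all singular
    values of Z equal lambda, and this is already absurd.

    The Hessian bounds enter only through cocoercivity, which reads
      < (mu X + Z) - (mu X' + Z'), (L X + Z) - (L X' + Z') >  <=  0.
    Expanding this in the two singular bases and bounding the overlaps of the
    bases by a doubly stochastic matrix T, the left-hand side is at least the
    T-average of products indexed by a singular pair of X and one of X'.  With b
    the smallest positive singular value of X, such a product is at least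
    L mu b^2 when only X is active, at least - L mu b^2 (kappa - 1)^2 / 4 when
    only X' is active (a quadratic in the singular value of X', minimized by
    completing the square), and nonnegative otherwise.  The T-masses of the two
    relevant blocks are r - w and rs - w, where w is the mass on which both are
    active, and the constraint rs - w <= min(rs, m - r) turns the condition into
    positivity of the average (misalignment_sum_gt0): a contradiction.

    Necessity.  The cases of equality above dictate the counterexample.  All
    matrices are diagonal: X is the identity of size r, while X' agrees with X
    on q of its entries, vanishes on the other r - q, and equals y on k new
    entries.  With D = X - X', E the prescribed difference of gradients and
    z = L D - E, the Hessian L Id - c z z^T maps D to E when c <z, D> = 1; it
    acts as L Id on off-diagonal entries, which makes the factorization of X
    second-order stationary (block_second_order_stationary), and it has spectrum
    in [mu, L] under a numerical inequality that is met by
    y = (kappa + 1) / 2 when the condition fails with rs <= r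
    (counterexample_weights).  When r < rs one takes z = 0.  Strong convexity
    makes X' the only minimizer, so X is not one. *)

(** * The trace inner product *)

Section InnerProduct.
Context {R : realType}.

Definition mdot {m n : nat} (A B : 'M[R]_(m, n)) : R := \tr (A^T *m B).

Lemma mdotE m n (A B : 'M[R]_(m, n)) : mdot A B = \sum_i \sum_j A i j * B i j.
Proof.
rewrite /mdot /mxtrace exchange_big /=; apply: eq_bigr => j _.
by rewrite mxE; apply: eq_bigr => i _; rewrite mxE.
Qed.

Lemma mdotC m n (A B : 'M[R]_(m, n)) : mdot A B = mdot B A.
Proof. by rewrite /mdot -mxtrace_tr trmx_mul trmxK. Qed.

Lemma mdotDl m n (A B C : 'M[R]_(m, n)) : mdot (A + B) C = mdot A C + mdot B C.
Proof. by rewrite /mdot linearD /= mulmxDl mxtraceD. Qed.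

Lemma mdotZl m n a (A B : 'M[R]_(m, n)) : mdot (a *: A) B = a * mdot A B.
Proof. by rewrite /mdot linearZ /= -scalemxAl mxtraceZ. Qed.

Lemma mdotNl m n (A B : 'M[R]_(m, n)) : mdot (- A) B = - mdot A B.
Proof. by rewrite -scaleN1r mdotZl mulN1r. Qed.

Lemma mdotBl m n (A B C : 'M[R]_(m, n)) : mdot (A - B) C = mdot A C - mdot B C.
Proof. by rewrite mdotDl mdotNl. Qed.

Lemma mdotDr m n (A B C : 'M[R]_(m, n)) : mdot A (B + C) = mdot A B + mdot A C.
Proof. by rewrite mdotC mdotDl !(mdotC _ A). Qed.

Lemma mdotZr m n a (A B : 'M[R]_(m, n)) : mdot A (a *: B) = a * mdot A B.
Proof. by rewrite mdotC mdotZl mdotC. Qed.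

Lemma mdotNr m n (A B : 'M[R]_(m, n)) : mdot A (- B) = - mdot A B.
Proof. by rewrite mdotC mdotNl mdotC. Qed.

Lemma mdotBr m n (A B C : 'M[R]_(m, n)) : mdot A (B - C) = mdot A B - mdot A C.
Proof. by rewrite mdotDr mdotNr. Qed.

Lemma mdot0l m n (A : 'M[R]_(m, n)) : mdot 0 A = 0.
Proof. by rewrite /mdot trmx0 mul0mx mxtrace0. Qed.

Lemma mdot0r m n (A : 'M[R]_(m, n)) : mdot A 0 = 0.
Proof. by rewrite mdotC mdot0l. Qed.

Lemma mdot_tr m n (A B : 'M[R]_(m, n)) : mdot A^T B^T = mdot A B.
Proof. by rewrite /mdot trmxK mxtrace_mulC -mxtrace_tr trmx_mul trmxK. Qed.

Lemma mdot_mull m n p (A : 'M[R]_(m, p)) (B : 'M[R]_(p, n)) (C : 'M[R]_(m, n)) :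
  mdot (A *m B) C = mdot B (A^T *m C).
Proof. by rewrite /mdot trmx_mul mulmxA. Qed.

Lemma mdot_mulr m n p (A : 'M[R]_(m, p)) (B : 'M[R]_(p, n)) (C : 'M[R]_(m, n)) :
  mdot (A *m B) C = mdot A (C *m B^T).
Proof. by rewrite /mdot trmx_mul -mulmxA mxtrace_mulC mulmxA. Qed.

Lemma mdot_ge0 m n (A : 'M[R]_(m, n)) : 0 <= mdot A A.
Proof.
by rewrite mdotE; do 2!apply: sumr_ge0 => ? _; rewrite -expr2 sqr_ge0.
Qed.

Lemma mdot_eq0 m n (A : 'M[R]_(m, n)) : mdot A A = 0 -> A = 0.
Proof.
rewrite mdotE => /eqP; rewrite psumr_eq0; last first.
  by move=> i _; apply: sumr_ge0 => j _; rewrite -expr2 sqr_ge0.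
move=> /allP A0; apply/matrixP => i j; rewrite mxE; apply/eqP.
have /A0 : i \in index_enum 'I_m by rewrite mem_index_enum.
rewrite /= psumr_eq0 => [/allP/(_ j)|k _]; last by rewrite -expr2 sqr_ge0.
by rewrite mem_index_enum mulf_eq0 orbb; apply.
Qed.

Lemma mdot_gt0 m n (A : 'M[R]_(m, n)) : A != 0 -> 0 < mdot A A.
Proof.
move=> A0; rewrite lt_neqAle mdot_ge0 andbT eq_sym.
by apply: contraNneq A0 => /mdot_eq0->.
Qed.

Lemma frobenius_normE m n (A : 'M[R]_(m, n)) : frobenius_norm A ^+ 2 = mdot A A.
Proof.
have h : 0 <= \sum_i \sum_j A i j ^+ 2.
  by do 2!apply: sumr_ge0 => ? _; exact: sqr_ge0.
rewrite mdotE /frobenius_norm sqr_sqrtr //.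
Qed.

Lemma mdot_rank1 m n (A : 'M[R]_(m, n)) (u : 'cV[R]_m) (v : 'cV[R]_n) :
  mdot A (u *m v^T) = mdot (A *m v) u.
Proof. by rewrite mdotC mdot_mulr trmxK mdotC. Qed.

(** Nonnegativity of the squared norm of <B, B> A - <A, B> B. *)
Lemma mdot_cauchy_schwarz m n (A B : 'M[R]_(m, n)) :
  mdot A B ^+ 2 <= mdot A A * mdot B B.
Proof.
have [->|B0] := eqVneq B 0; first by rewrite !mdot0r expr0n mulr0.
have Bp := mdot_gt0 B0.
have := mdot_ge0 (mdot B B *: A - mdot A B *: B).
rewrite mdotBl !mdotBr !mdotZl !mdotZr (mdotC B A).
set a := mdot A A; set b := mdot B B; set c := mdot A B => h.
by rewrite -subr_ge0 -(pmulr_rge0 _ Bp) -/b; move: h; congr (0 <= _); ring.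
Qed.

Lemma mdot_delta n (i : 'I_n) : mdot (delta_mx i 0 : 'cV[R]_n) (delta_mx i 0) = 1.
Proof.
rewrite mdotE (bigD1 i) //= big_ord1 mxE !eqxx mulr1 big1 ?addr0 // => j ji.
by rewrite big_ord1 !mxE (negbTE ji) mul0r.
Qed.

Lemma mdot_suml m n I (r : seq I) (F : I -> 'M[R]_(m, n)) A :
  mdot (\sum_(i <- r) F i) A = \sum_(i <- r) mdot (F i) A.
Proof.
elim/big_rec2: _ => [|i x y _ <-]; first exact: mdot0l.
exact: mdotDl.
Qed.

Lemma mdot_sumr m n I (r : seq I) (F : I -> 'M[R]_(m, n)) A :
  mdot A (\sum_(i <- r) F i) = \sum_(i <- r) mdot A (F i).
Proof. by rewrite mdotC mdot_suml; apply: eq_bigr => i _; rewrite mdotC. Qed.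

Lemma trmx_mul_cV n (u v : 'cV[R]_n) : u^T *m v = (mdot u v)%:M.
Proof. by rewrite [LHS]mx11_scalar /mdot trace_mx11. Qed.

Lemma mdot_rank1_rank1 m n (u u' : 'cV[R]_m) (v v' : 'cV[R]_n) :
  mdot (u *m v^T) (u' *m v'^T) = mdot u u' * mdot v v'.
Proof.
by rewrite mdot_rank1 -mulmxA trmx_mul_cV mul_mx_scalar mdotZl mulrC.
Qed.

Lemma mdot_block_mx m1 m2 n1 n2 (A A' : 'M[R]_(m1, n1)) (B B' : 'M[R]_(m1, n2))
    (C C' : 'M[R]_(m2, n1)) (D D' : 'M[R]_(m2, n2)) :
  mdot (block_mx A B C D) (block_mx A' B' C' D') =
  mdot A A' + mdot B B' + mdot C C' + mdot D D'.
Proof.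
by rewrite /mdot tr_block_mx mulmx_block mxtrace_block !mxtraceD; ring.
Qed.

Lemma mdot_col_mx m1 m2 n (A A' : 'M[R]_(m1, n)) (B B' : 'M[R]_(m2, n)) :
  mdot (col_mx A B) (col_mx A' B') = mdot A A' + mdot B B'.
Proof. by rewrite /mdot tr_col_mx mul_row_col mxtraceD. Qed.

End InnerProduct.

(** * Differentiability of matrix-valued maps *)

Section Differentiability.
Context {R : realType}.

Lemma differentiable_bigsum (V W : normedModType R) n (f : 'I_n -> V -> W)
    (x : V) : (forall i, differentiable (f i) x) ->
  differentiable (fun y => \sum_(i < n) f i y) x.
Proof.
move=> df; have -> : (fun y => \sum_(i < n) f i y) = \sum_(i < n) f i.
  by apply/funext => y; rewrite fct_sumE.
exact: differentiable_sum.
Qed.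

Lemma differentiable_mdot (V : normedModType R) m n (f g : V -> 'M[R]_(m, n))
    (x : V) : differentiable f x -> differentiable g x ->
  differentiable (fun y => mdot (f y) (g y)) x.
Proof.
move=> df dg; have -> : (fun y => mdot (f y) (g y)) =
    (fun y => \sum_i \sum_j f y i j * g y i j).
  by apply/funext => y; rewrite mdotE.
apply: differentiable_bigsum => i; apply: differentiable_bigsum => j.
apply: differentiableM.
  exact: (differentiable_comp df (differentiable_coord _ i j)).
exact: (differentiable_comp dg (differentiable_coord _ i j)).
Qed.

Lemma differentiable_mx (V : normedModType R) m n (f : V -> 'M[R]_(m, n))
    (x : V) : (forall i j, differentiable (fun y => f y i j) x) ->
  differentiable f x.
Proof.
move=> df; have -> : f = (fun y => \sum_i \sum_j f y i j *: delta_mx i j).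
  by apply/funext => y; exact: matrix_sum_delta.
apply: differentiable_bigsum => i; apply: differentiable_bigsum => j.
exact: differentiableZl.
Qed.

Lemma differentiable_mulmx (V : normedModType R) m n p (f : V -> 'M[R]_(m, n))
    (A : 'M[R]_(n, p)) (x : V) : differentiable f x ->
  differentiable (fun y => f y *m A) x.
Proof.
move=> df; apply: differentiable_mx => i j.
have -> : (fun y => (f y *m A) i j) = (fun y => \sum_k f y i k * A k j).
  by apply/funext => y; rewrite mxE.
apply: differentiable_bigsum => k; apply: differentiableM => //.
exact: (differentiable_comp df (differentiable_coord _ i k)).
Qed.

End Differentiability.

(** * Simultaneous singular value decomposition *)

Section SVD.
Context {R : realType}.

Lemma sphere_compact n : compact [set x : 'rV[R]_n | mdot x x = 1].
Proof.
have cont : continuous (fun x : 'rV[R]_n => mdot x x).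
  by move=> x; apply/differentiable_continuous/differentiable_mdot.
apply: bounded_closed_compact.
  exists 1; split; first exact: num_real.
  move=> M M1 x /= x1; rewrite [leLHS]mx_normrE.
  apply: bigmax_le => [|[i j] _ /=]; first by lra.
  apply: (@le_trans _ _ 1); last exact: ltW.
  rewrite -(@ler_pXn2r _ 2) ?nnegrE // expr1n -normrX ger0_norm ?sqr_ge0 //.
  rewrite -x1 mdotE.
  rewrite (bigD1 i) //= (bigD1 j) //= -expr2 -addrA lerDl addr_ge0 //.
    by apply: sumr_ge0 => ? _; rewrite -expr2 sqr_ge0.
  by do 2!apply: sumr_ge0 => ? _; rewrite -expr2 sqr_ge0.
apply: (@preimage_closed _ _ (fun x : 'rV[R]_n => mdot x x) [set 1]) => //.
Qed.

(** If a were nonzero, the value t = - a / (b + 1), which minimizes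
    2 t a + t^2 (b + 1), would make the polynomial negative. *)
Lemma linear_term_eq0 (a b : R) :
  (forall t, 0 <= 2 * t * a + t ^+ 2 * b) -> a = 0.
Proof.
move=> h; apply/eqP; apply: contraT => a0.
have b0 : 0 <= b by have := h 1; have := h (-1); lra.
have /= := h (- a / (b + 1)).
have bp : 0 < b + 1 by lra.
have a2 : 0 < a ^+ 2 by rewrite exprn_even_gt0.
have -> : 2 * (- a / (b + 1)) * a + (- a / (b + 1)) ^+ 2 * b =
   - (a ^+ 2 * (b + 2) / (b + 1) ^+ 2) by field; rewrite gt_eqF.
rewrite oppr_ge0 leNgt => /negP[].
apply: divr_gt0; last exact: exprn_gt0.
by apply: mulr_gt0 => //; lra.
Qed.

(** A maximizer v of |A v| on the unit sphere is a top singular vector: by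
    homogeneity M |w|^2 - |A w|^2 >= 0 with equality at v, and the first-order
    term of this nonnegative form at v must vanish.  Maximality is also what
    makes the singular value positive when A is nonzero. *)
Lemma exists_singular_pair m n (A : 'M[R]_(m.+1, n.+1)) :
  exists (u : 'cV[R]_m.+1) (v : 'cV[R]_n.+1) (d : R),
    [/\ mdot u u = 1, mdot v v = 1, 0 <= d,
        A *m v = d *: u /\ A^T *m u = d *: v & A != 0 -> 0 < d].
Proof.
have [->|A0] := eqVneq A 0.
  exists (delta_mx ord0 0), (delta_mx ord0 0), 0.
  by rewrite !mdot_delta trmx0 !mul0mx !scale0r lexx; split.
pose f (x : 'rV[R]_n.+1) := mdot (x *m A^T) (x *m A^T).
have fd x : differentiable f x.
  have lin : differentiable (fun x : 'rV[R]_n.+1 => x *m A^T) x.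
    exact: differentiable_mulmx.
  exact: differentiable_mdot.
have [||c] := EVT_max_rV (f := f) _ (@sphere_compact n.+1).
- exists (delta_mx 0 ord0); rewrite /=.
  rewrite -[X in mdot X _]trmxK -[X in mdot _ X]trmxK.
  by rewrite mdot_tr !trmx_delta mdot_delta.
- by apply: continuous_subspaceT => x; exact/differentiable_continuous.
rewrite inE /= => c1 cmax; set M := f c.
have fM w : f w <= M * mdot w w.
  have [->|w0] := eqVneq w 0; first by rewrite /f mul0mx !mdot0l mulr0.
  have wp := mdot_gt0 w0; have wp0 := ltW wp.
  have /cmax : ((Num.sqrt (mdot w w))^-1 *: w) \in
      [set x : 'rV[R]_n.+1 | mdot x x = 1].
    rewrite inE /= mdotZl mdotZr mulrA -expr2 exprVn sqr_sqrtr // mulVf ?gt_eqF //.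
  rewrite {1}/f -scalemxAl mdotZl mdotZr mulrA -expr2 exprVn sqr_sqrtr //.
  by rewrite ler_pdivrMl // mulrC.
have eig : c *m A^T *m A = M *: c.
  apply/eqP; rewrite -subr_eq0; apply/eqP/mdot_eq0.
  have [w wE] : exists w, w = c *m A^T *m A - M *: c by eexists.
  rewrite -wE; apply: (@linear_term_eq0 _ (M * mdot w w - f w)) => t.
  have ww : mdot w w = mdot (c *m A^T) (w *m A^T) - M * mdot c w.
    by rewrite {1}wE mdotBl mdotZl mdot_mulr.
  rewrite {1}ww.
  have := fM (c - t *: w); rewrite -subr_ge0 /f mulmxBl -scalemxAl.
  rewrite !mdotBl !mdotBr !mdotZl !mdotZr -/(f c) -/(f w) -/M c1.
  rewrite (mdotC w c) (mdotC (w *m A^T)) => /le_trans; apply.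
  rewrite le_eqVlt; apply/orP; left; apply/eqP.
  rewrite /f; ring.
have M0 : 0 < M.
  rewrite lt_neqAle mdot_ge0 andbT; apply: contraNneq A0 => M0.
  apply/eqP/trmx_inj/matrixP => i j; rewrite trmx0.
  have : (delta_mx 0 i : 'rV[R]_n.+1) *m A^T = 0.
    apply: mdot_eq0; apply/eqP; rewrite eq_le mdot_ge0 andbT.
    by have := fM (delta_mx 0 i); rewrite -M0 mul0r.
  by rewrite -rowE => /matrixP/(_ 0 j); rewrite !mxE.
have d0 : 0 < Num.sqrt M by rewrite sqrtr_gt0.
have dN : Num.sqrt M != 0 by rewrite gt_eqF.
have dd : Num.sqrt M * Num.sqrt M = M by rewrite -expr2 sqr_sqrtr // ltW.
exists ((Num.sqrt M)^-1 *: (A *m c^T)), c^T, (Num.sqrt M).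
have Ac : A *m c^T = (c *m A^T)^T by rewrite trmx_mul trmxK.
split => //.
- by rewrite Ac mdotZl mdotZr mdot_tr -/(f c) -/M -{3}dd; field.
- by rewrite mdot_tr.
- split; first by rewrite scalerA mulfV // scale1r.
  rewrite -scalemxAr.
  have -> : A^T *m (A *m c^T) = (c *m A^T *m A)^T by rewrite !trmx_mul trmxK.
  by rewrite eig linearZ /= scalerA -{2}dd mulKf.
Qed.

(** The Householder reflection exchanging u and the first basis vector. *)
Lemma exists_orthogonal_first_col n (u : 'cV[R]_n.+1) : mdot u u = 1 ->
  exists H : 'M[R]_n.+1, [/\ H^T = H, H *m H = 1%:M & H *m delta_mx ord0 0 = u].
Proof.
move=> u1; set e : 'cV[R]_n.+1 := delta_mx ord0 0.
have e1 : mdot e e = 1 by rewrite mdot_delta.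
have [->|ue] := eqVneq u e.
  by exists 1%:M; rewrite trmx1 mulmx1 mul1mx.
set w := u - e.
have wp : 0 < mdot w w by apply: mdot_gt0; rewrite subr_eq0.
have wwE : mdot w w = 2 - 2 * mdot u e.
  by rewrite /w mdotBl !mdotBr u1 e1 (mdotC e u); ring.
exists (1%:M - (2 / mdot w w) *: (w *m w^T)); split.
- by rewrite linearB linearZ /= trmx1 trmx_mul trmxK.
- rewrite mulmxBl mul1mx mulmxBr mulmx1 -scalemxAl -!scalemxAr.
  have -> : w *m w^T *m (w *m w^T) = mdot w w *: (w *m w^T).
    by rewrite mulmxA -(mulmxA w) trmx_mul_cV mul_mx_scalar -scalemxAl.
  rewrite !scalerA. set a := 2 / _.
  have -> : a * a * mdot w w = a + a by rewrite /a; field; exact: lt0r_neq0.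
  by rewrite scalerDl opprB addrK subrK.
- rewrite mulmxBl mul1mx -scalemxAl -mulmxA trmx_mul_cV mul_mx_scalar scalerA.
  rewrite (_ : _ * _ = -1) ?scaleN1r ?opprK 1?addrC ?subrK //.
  rewrite wwE /w mdotBl e1; field.
  by rewrite -wwE lt0r_neq0.
Qed.

(** After the two reflections the singular pair becomes the first pair of
    basis vectors, which splits off. *)
Lemma deflate_singular_pair m n (A : 'M[R]_(1 + m, 1 + n)) (H1 : 'M[R]_(1 + m))
    (H2 : 'M[R]_(1 + n)) d :
  H1^T = H1 -> H2^T = H2 -> H1 *m H1 = 1%:M -> H2 *m H2 = 1%:M ->
  A *m (H2 *m delta_mx ord0 0) = d *: (H1 *m delta_mx ord0 (0 : 'I_1)) ->
  A^T *m (H1 *m delta_mx ord0 0) = d *: (H2 *m delta_mx ord0 (0 : 'I_1)) ->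
  exists A' : 'M[R]_(m, n),
    A = H1 *m (block_mx d%:M 0 0 A' : 'M[R]_(1 + m, 1 + n)) *m H2.
Proof.
move=> H1T H2T H1K H2K Av ATu.
pose B : 'M[R]_(1 + m, 1 + n) := H1 *m A *m H2.
have BA : A = H1 *m B *m H2.
  by rewrite /B !mulmxA H1K mul1mx -mulmxA H2K mulmx1.
exists (drsubmx B); rewrite {1}BA; congr (_ *m _ *m _).
have Bc i : B i ord0 = d * (i == ord0)%:R.
  have : B *m delta_mx ord0 (0 : 'I_1) = d *: delta_mx ord0 0.
    by rewrite /B -!mulmxA Av -scalemxAr mulmxA H1K mul1mx.
  by rewrite -colE => /matrixP/(_ i 0); rewrite !mxE eqxx andbT.
have Br j : B ord0 j = d * (j == ord0)%:R.
  have : B^T *m delta_mx ord0 (0 : 'I_1) = d *: delta_mx ord0 0.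
    by rewrite /B !trmx_mul H1T H2T -!mulmxA ATu -scalemxAr mulmxA H2K mul1mx.
  by rewrite -colE => /matrixP/(_ j 0); rewrite !mxE eqxx andbT.
have l0 k : lshift k (0 : 'I_1) = ord0 by exact: val_inj.
clearbody B; have ul : ulsubmx B = d%:M.
  apply/matrixP => i j; rewrite !mxE (ord1 i) (ord1 j) !l0.
  by rewrite Bc eqxx mulr1.
have ur : ursubmx B = 0.
  apply/matrixP => i j; rewrite !mxE (ord1 i) l0 Br.
  by case: eqP => [/(congr1 val)//|_]; rewrite mulr0.
have dl : dlsubmx B = 0.
  apply/matrixP => i j; rewrite !mxE (ord1 j) l0 Bc.
  by case: eqP => [/(congr1 val)//|_]; rewrite mulr0.
by rewrite -{1}[B]submxK ul ur dl.
Qed.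

(** Induction on m, peeling off one common singular pair at a time: a pair of
    X with positive value while X is nonzero, which by hypothesis is a pair of
    Z with value lam, and then arbitrary pairs of Z.  The hypothesis passes to
    the deflated matrices because padding by zero preserves singular pairs. *)
Lemma joint_svd lam (hlam : 0 < lam) m n (X Z : 'M[R]_(m, n)) : (m <= n)%N ->
  (forall (u : 'cV[R]_m) (v : 'cV[R]_n) d, 0 < d ->
     X *m v = d *: u -> X^T *m u = d *: v ->
     Z *m v = lam *: u /\ Z^T *m u = lam *: v) ->
  exists (P : 'M[R]_m) (W : 'M[R]_(n, m)) (s g : 'rV[R]_m),
    [/\ P^T *m P = 1%:M, W^T *m W = 1%:M, X = P *m diag_mx s *m W^T,
        Z = P *m diag_mx g *m W^T
      & forall i, [/\ 0 <= s 0 i, 0 <= g 0 i & 0 < s 0 i -> g 0 i = lam]].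
Proof.
elim: m n X Z => [|m IH] n X Z mn hXZ.
  exists 1%:M, 0, 0, 0; split; try by apply/matrixP => -[].
  by case.
case: n X Z mn hXZ => // n.
rewrite -[m.+1]/(1 + m)%N -[n.+1]/(1 + n)%N => X Z mn hXZ.
have [u [v [d [e [u1 v1 [Xv XTu] [Zv ZTu] [d0 e0 de]]]]]] :
    exists (u : 'cV[R]_(1 + m)) (v : 'cV[R]_(1 + n)) (d e : R),
    [/\ mdot u u = 1, mdot v v = 1,
        X *m v = d *: u /\ X^T *m u = d *: v,
        Z *m v = e *: u /\ Z^T *m u = e *: v
      & [/\ 0 <= d, 0 <= e & 0 < d -> e = lam]].
  have [X0|X0] := eqVneq X 0.
    have [u [v [e [u1 v1 e0 Ze _]]]] := exists_singular_pair Z.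
    exists u, v, 0, e; split => //; last by split => //; rewrite ltxx.
    by rewrite X0 trmx0 !mul0mx !scale0r.
  have [u [v [d [u1 v1 d0 [Xv XTu] /(_ X0) d1]]]] := exists_singular_pair X.
  exists u, v, d, lam; split => //; first exact: (hXZ _ _ _ d1).
  by split => //; exact: ltW.
have [H1 [H1T H1K H1u]] : exists H : 'M[R]_(1 + m),
    [/\ H^T = H, H *m H = 1%:M & H *m delta_mx ord0 0 = u].
  exact: exists_orthogonal_first_col.
have [H2 [H2T H2K H2v]] : exists H : 'M[R]_(1 + n),
    [/\ H^T = H, H *m H = 1%:M & H *m delta_mx ord0 0 = v].
  exact: exists_orthogonal_first_col.
rewrite -H1u -H2v in Xv XTu Zv ZTu.
have [X' XE] := deflate_singular_pair H1T H2T H1K H2K Xv XTu.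
have [Z' ZE] := deflate_singular_pair H1T H2T H1K H2K Zv ZTu.
have [||P' [W' [s [g [P'1 W'1 X'E Z'E sg]]]]] := IH n X' Z' => //.
  move=> u' v' d' d'0 X'v X'u.
  have := hXZ (H1 *m (col_mx 0 u' : 'cV[R]_(1 + m)))
             (H2 *m (col_mx 0 v' : 'cV[R]_(1 + n))) d' d'0.
  rewrite XE ZE !trmx_mul H1T H2T !tr_block_mx !trmx0 !tr_scalar_mx.
  rewrite -!mulmxA !(mulmxA H1 H1) !(mulmxA H2 H2) H1K H2K !mul1mx.
  rewrite !scalemxAr.
  have inj k (H : 'M[R]_k) (x y : 'cV[R]_k) : H *m H = 1%:M ->
      H *m x = H *m y -> x = y.
    by move=> HK /(congr1 (mulmx H)); rewrite !mulmxA HK !mul1mx.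
  rewrite !mul_block_col !mul0mx !mulmx0 !add0r X'v X'u !scale_col_mx !scaler0.
  case=> // /(inj _ _ _ _ H1K)/eq_col_mx[_ ->].
  by move=> /(inj _ _ _ _ H2K)/eq_col_mx[_ ->].
pose P : 'M[R]_(1 + m) := H1 *m (block_mx 1%:M 0 0 P' : 'M[R]_(1 + m)).
pose W : 'M[R]_(1 + n, 1 + m) :=
  H2 *m (block_mx 1%:M 0 0 W' : 'M[R]_(1 + n, 1 + m)).
have diagE (t : R) (x : 'rV[R]_m) (M : 'M[R]_(m, n)) :
    M = P' *m diag_mx x *m W'^T ->
    H1 *m (block_mx t%:M 0 0 M : 'M[R]_(1 + m, 1 + n)) *m H2 =
    P *m diag_mx (row_mx t%:M x : 'rV[R]_(1 + m)) *m W^T.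
  move=> ->; rewrite diag_mx_row /P /W trmx_mul H2T -!mulmxA.
  congr (_ *m _); rewrite !mulmxA; congr (_ *m _).
  have -> : diag_mx (t%:M : 'rV[R]_1) = t%:M.
    by apply/matrixP => i j; rewrite !mxE !ord1 eqxx.
  rewrite tr_block_mx !trmx0 !trmx1 !mulmx_block.
  by rewrite !(mulmx0, mul0mx, mulmx1, mul1mx, addr0, add0r).
have one k : block_mx 1%:M 0 0 1%:M = (1%:M : 'M[R]_(1 + k)).
  by rewrite -scalar_mx_block.
exists P, W, (row_mx d%:M s : 'rV[R]_(1 + m)), (row_mx e%:M g : 'rV[R]_(1 + m)).
split.
- rewrite /P trmx_mul H1T -mulmxA (mulmxA H1) H1K mul1mx tr_block_mx mulmx_block.
  by rewrite !trmx0 !(mulmx0, mul0mx, addr0, add0r) P'1 trmx1 mulmx1 one.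
- rewrite /W trmx_mul H2T -mulmxA (mulmxA H2) H2K mul1mx tr_block_mx mulmx_block.
  by rewrite !trmx0 !(mulmx0, mul0mx, addr0, add0r) W'1 trmx1 mulmx1 one.
- by rewrite XE; exact: diagE.
- by rewrite ZE; exact: diagE.
- move=> i; rewrite !mxE; case: split_ordP => j _; last exact: sg.
  by rewrite !mxE ord1 eqxx.
Qed.

(** The stationarity equations give U^T U = V^T V, hence
    (U U^T)^2 = X X^T for X = U V^T.  On a singular pair (u, v) of X with value
    d > 0 the positive semidefinite square root U U^T acts as d, and
    Z X^T = lambda U U^T then shows that Z maps v to lambda u. *)
Lemma balanced_joint_svd m n k (lambda : R) (U : 'M[R]_(m, k)) (V : 'M[R]_(n, k))
    (Z : 'M[R]_(m, n)) : (m <= n)%N -> 0 < lambda ->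
  Z *m V = lambda *: U -> Z^T *m U = lambda *: V ->
  exists (P : 'M[R]_m) (W : 'M[R]_(n, m)) (s g : 'rV[R]_m),
    [/\ P^T *m P = 1%:M, W^T *m W = 1%:M, U *m V^T = P *m diag_mx s *m W^T,
        Z = P *m diag_mx g *m W^T
      & forall i, [/\ 0 <= s 0 i, 0 <= g 0 i & 0 < s 0 i -> g 0 i = lambda]].
Proof.
move=> mn l0 ZV ZU; apply: joint_svd => // u v d d0 Xv Xu.
have lN : lambda != 0 by rewrite gt_eqF.
have dN : d != 0 by rewrite gt_eqF.
have bal : U^T *m U = V^T *m V.
  have VZ : lambda *: V^T = U^T *m Z.
    by rewrite -[Z]trmxK -trmx_mul ZU linearZ.
  by apply: (scalerI lN); rewrite scalemxAr -ZV mulmxA -VZ scalemxAl.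
have root p (A : 'M[R]_(p, k)) (x : 'cV[R]_p) :
    A *m A^T *m (A *m A^T *m x) = d ^+ 2 *: x -> A *m A^T *m x = d *: x.
  move=> A2; apply/eqP; rewrite -subr_eq0; apply/eqP.
  set y := _ - _.
  have : A *m A^T *m y + d *: y = 0.
    by rewrite /y mulmxBr A2 -scalemxAr scalerBr scalerA -expr2 addrC subrKA subrr.
  move=> e; have : mdot (A *m (A^T *m y) + d *: y) y = 0.
    by rewrite mulmxA e mdot0l.
  rewrite mdotDl mdotZl mdot_mull => {}e; apply: mdot_eq0.
  have := mdot_ge0 (A^T *m y); have := mdot_ge0 y.
  rewrite le_eqVlt => /orP[/eqP->//|yy]; have := mulr_gt0 d0 yy; lra.
rewrite trmx_mul trmxK in Xu.
have XXu : U *m V^T *m (V *m U^T *m u) = d ^+ 2 *: u.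
  by rewrite Xu -scalemxAr Xv scalerA.
have XXv : V *m U^T *m (U *m V^T *m v) = d ^+ 2 *: v.
  by rewrite Xv -scalemxAr Xu scalerA.
have UUu : U *m U^T *m u = d *: u.
  apply: root; rewrite -XXu !mulmxA -(mulmxA U U^T U) bal.
  by rewrite -[in RHS](mulmxA U V^T V).
have VVv : V *m V^T *m v = d *: v.
  apply: root; rewrite -XXv !mulmxA -(mulmxA V V^T V) -bal.
  by rewrite -[in RHS](mulmxA V U^T U).
split; apply: (scalerI dN).
  rewrite scalemxAr -Xu !mulmxA ZV -!scalemxAl UUu !scalerA mulrC //.
rewrite scalemxAr -Xv !mulmxA ZU -!scalemxAl VVv !scalerA mulrC //.
Qed.

End SVD.

(** * Matrices in singular coordinates *)

Section SingularCoordinates.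
Context {R : realType}.

Lemma svd_exists m n (X : 'M[R]_(m, n)) : (m <= n)%N ->
  exists (P : 'M[R]_m) (W : 'M[R]_(n, m)) (s : 'rV[R]_m),
    [/\ P^T *m P = 1%:M, W^T *m W = 1%:M, X = P *m diag_mx s *m W^T
      & forall i, 0 <= s 0 i].
Proof.
move=> mn.
have [|P [W [z [s H]]]] := @joint_svd R 1 ltr01 m n 0 X mn.
  move=> u v d d0; rewrite mul0mx => /esym/eqP; rewrite scaler_eq0 gt_eqF //=.
  move=> /eqP->; rewrite trmx0 mulmx0 => /esym/eqP.
  by rewrite scaler_eq0 gt_eqF //= => /eqP->; rewrite !mulmx0 !scaler0.
by case: H => PP WW _ XE s0; exists P, W, s; split => // i; case: (s0 i).
Qed.

Lemma mul_diag_expand m n (P : 'M[R]_m) (W : 'M[R]_(n, m)) (s : 'rV[R]_m) :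
  P *m diag_mx s *m W^T = \sum_i s 0 i *: (col i P *m (col i W)^T).
Proof.
apply/matrixP => i j; rewrite !mxE summxE; apply: eq_bigr => k _.
by rewrite mul_mx_diag !mxE big_ord1 !mxE mulrCA mulrA.
Qed.

Lemma col_orthonormal m n (P : 'M[R]_(n, m)) i j : P^T *m P = 1%:M ->
  mdot (col i P) (col j P) = (i == j)%:R.
Proof.
move=> /matrixP/(_ i j); rewrite !mxE => <-; rewrite mdotE.
by apply: eq_bigr => k _; rewrite big_ord1 !mxE.
Qed.

Lemma rank_diag m (s : 'rV[R]_m) :
  \rank (diag_mx s) = (\sum_i (s 0%R i != 0%R))%N.
Proof.
elim: m s => [|m IH] s; first by rewrite big_ord0 flatmx0 mxrank0.
rewrite -[m.+1]/(1 + m)%N in s *; rewrite -[s]hsubmxK diag_mx_row.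
rewrite rank_diag_block_mx IH big_split_ord /=; congr (_ + _)%N; last first.
  by apply: eq_bigr => i _; rewrite row_mxEr.
rewrite big_ord1 row_mxEl.
have -> : diag_mx (lsubmx s) = lsubmx s.
  by apply/matrixP => i j; rewrite !ord1 !mxE.
rewrite rank_rV; congr (nat_of_bool (~~ _)).
apply/eqP/eqP => [->|e]; first by rewrite mxE.
by apply/matrixP => i j; rewrite !ord1 e mxE.
Qed.

Lemma rank_svd m n (P : 'M[R]_m) (W : 'M[R]_(n, m)) (s : 'rV[R]_m) :
  P^T *m P = 1%:M -> W^T *m W = 1%:M -> (forall i, 0 <= s 0 i) ->
  \rank (P *m diag_mx s *m W^T) = #|[pred i | 0 < s 0 i]|.
Proof.
move=> PP WW s0; rewrite mxrankMfree; last by apply/row_freeP; exists W.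
rewrite -mxrank_tr trmx_mul mxrankMfree ?tr_diag_mx; last first.
  by apply/row_freeP; exists P.
rewrite rank_diag -sum1_card [RHS]big_mkcond /=; apply: eq_bigr => i _.
by rewrite inE lt_neqAle s0 andbT eq_sym; case: eqP.
Qed.

Lemma mdot_svd m n (P P' : 'M[R]_m) (W W' : 'M[R]_(n, m)) (a b : 'rV[R]_m) :
  mdot (P *m diag_mx a *m W^T) (P' *m diag_mx b *m W'^T) =
  \sum_i \sum_j a 0 i * b 0 j *
    (mdot (col i P) (col j P') * mdot (col i W) (col j W')).
Proof.
rewrite !mul_diag_expand mdot_suml; apply: eq_bigr => i _.
rewrite mdot_sumr; apply: eq_bigr => j _.
by rewrite mdotZl mdotZr mdot_rank1_rank1 mulrA.
Qed.

Lemma mdot_svd_same m n (P : 'M[R]_m) (W : 'M[R]_(n, m)) (a b : 'rV[R]_m) :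
  P^T *m P = 1%:M -> W^T *m W = 1%:M ->
  mdot (P *m diag_mx a *m W^T) (P *m diag_mx b *m W^T) =
  \sum_i a 0 i * b 0 i.
Proof.
move=> PP WW; rewrite mdot_svd; apply: eq_bigr => i _.
rewrite (bigD1 i) //= !col_orthonormal // eqxx !mulr1 big1 ?addr0 // => j.
by rewrite !col_orthonormal // eq_sym => /negbTE->; rewrite !mulr0.
Qed.

Lemma svd_mul_col m n (P : 'M[R]_m) (W : 'M[R]_(n, m)) (s : 'rV[R]_m) i :
  W^T *m W = 1%:M -> P *m diag_mx s *m W^T *m col i W = s 0 i *: col i P.
Proof.
move=> WW; rewrite mul_diag_expand mulmx_suml.
have scal k : (col k W)^T *m col i W = (k == i)%:R%:M.
  by rewrite trmx_mul_cV col_orthonormal.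
rewrite (bigD1 i) //= big1 ?addr0 => [|k /negbTE ki].
  by rewrite -scalemxAl -mulmxA scal eqxx mulmx1.
by rewrite -scalemxAl -mulmxA scal ki raddf0 mulmx0 scaler0.
Qed.

Lemma svd_trmul_col m n (P : 'M[R]_m) (W : 'M[R]_(n, m)) (s : 'rV[R]_m) i :
  P^T *m P = 1%:M -> (P *m diag_mx s *m W^T)^T *m col i P = s 0 i *: col i W.
Proof.
move=> PP; rewrite mul_diag_expand linear_sum mulmx_suml.
have scal k : (col k P)^T *m col i P = (k == i)%:R%:M.
  by rewrite trmx_mul_cV col_orthonormal.
rewrite (bigD1 i) //= big1 ?addr0 => [|k /negbTE ki].
  by rewrite linearZ /= trmx_mul trmxK -scalemxAl -mulmxA scal eqxx mulmx1.
rewrite linearZ /= trmx_mul trmxK -scalemxAl -mulmxA scal ki.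
by rewrite raddf0 mulmx0 scaler0.
Qed.

Lemma bessel m n (P : 'M[R]_(n, m)) (u : 'cV[R]_n) : P^T *m P = 1%:M ->
  \sum_i mdot (col i P) u ^+ 2 <= mdot u u.
Proof.
move=> PP; pose y := P^T *m u.
have -> : \sum_i mdot (col i P) u ^+ 2 = mdot y y.
  rewrite mdotE; apply: eq_bigr => i _; rewrite big_ord1 expr2.
  suff -> : y i 0 = mdot (col i P) u by [].
  by rewrite /y mxE mdotE; apply: eq_bigr => k _; rewrite big_ord1 !mxE.
have := mdot_ge0 (u - P *m y); rewrite mdotBl !mdotBr.
rewrite (mdotC u) !mdot_mull [P^T *m (P *m y)]mulmxA PP mul1mx -/y; lra.
Qed.

End SingularCoordinates.

(** * The nuclear norm and its dual unit ball *)

Section NuclearNorm.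
Context {R : realType}.

Lemma char_poly_conj_orthogonal m (P A : 'M[R]_m) : P^T *m P = 1%:M ->
  char_poly (P *m A *m P^T) = char_poly A.
Proof.
move=> PP; have PPT : P *m P^T = 1%:M by exact: mulmx1C.
rewrite /char_poly /char_poly_mx.
have -> : 'X%:M - map_mx polyC (P *m A *m P^T) =
    map_mx polyC P *m ('X%:M - map_mx polyC A) *m map_mx polyC P^T.
  rewrite mulmxBr mulmxBl !map_mxM /= scalar_mxC; congr (_ - _).
  by rewrite -mulmxA -map_mxM PPT map_mx1 mulmx1.
rewrite !det_mulmx mulrC mulrA -det_mulmx -map_mxM PP map_mx1 det1.
by rewrite mul1r.
Qed.

(** Grouping the list t by values turns the multiplicities of the roots into
    repetitions. *)
Lemma sum_singular_values m n (X : 'M[R]_(m, n)) (t : seq R) :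
  char_poly (X *m X^T) = \prod_(b <- t) ('X - b%:P) ->
  nuclear_norm X = \sum_(b <- t) Num.sqrt b.
Proof.
move=> pE; rewrite /nuclear_norm /singular_values pE.
set p := \prod_(b <- t) _.
have p0 : p != 0 by rewrite monic_neq0 ?monic_prod_XsubC.
have rt : perm_eq (rootsR p) (undup t).
  apply: uniq_perm; rewrite ?undup_uniq ?uniq_roots // => x.
  have := roots_on_rootsR p0 x; rewrite in_itv /= => <-.
  by rewrite root_prod_XsubC mem_undup.
rewrite big_flatten big_map (perm_big _ rt) /=.
rewrite -(perm_big _ (perm_count_undup t)) big_flatten big_map /=.
by apply: eq_bigr => a _; rewrite !big_nseq mu_prod_XsubC.
Qed.

Lemma nuclear_norm_svd m n (P : 'M[R]_m) (W : 'M[R]_(n, m)) (s : 'rV[R]_m) :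
  P^T *m P = 1%:M -> W^T *m W = 1%:M -> (forall i, 0 <= s 0 i) ->
  nuclear_norm (P *m diag_mx s *m W^T) = \sum_i s 0 i.
Proof.
move=> PP WW s0.
rewrite (@sum_singular_values _ _ _ [seq s 0 i ^+ 2 | i : 'I_m]).
  rewrite big_map big_enum /=; apply: eq_bigr => i _.
  by rewrite sqrtr_sqr ger0_norm.
rewrite !trmx_mul trmxK tr_diag_mx !mulmxA -(mulmxA _ W^T) WW mulmx1.
rewrite -(mulmxA P) mulmx_diag char_poly_conj_orthogonal //.
rewrite char_poly_trig ?diag_mx_is_trig // big_map big_enum /=.
by apply: eq_bigr => i _; rewrite !mxE eqxx expr2.
Qed.

(** The unit ball of the operator norm: by homogeneity the half sum of squares
    may replace the product of the norms, which avoids square roots. *)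
Definition contraction {m n : nat} (Z : 'M[R]_(m, n)) :=
  forall (u : 'cV[R]_m) (v : 'cV[R]_n),
    mdot Z (u *m v^T) <= (mdot u u + mdot v v) / 2.

(** Together with nuclear_norm_attained: the nuclear norm is the support
    function of the unit ball of the operator norm. *)
Lemma contraction_le_nuclear_norm m n (Z X : 'M[R]_(m, n)) : (m <= n)%N ->
  contraction Z -> mdot Z X <= nuclear_norm X.
Proof.
move=> mn Z1; have [P [W [s [PP WW -> s0]]]] := svd_exists X mn.
rewrite nuclear_norm_svd // mul_diag_expand mdot_sumr ler_sum // => i _.
rewrite mdotZr -[leRHS]mulr1 ler_wpM2l //.
have := Z1 (col i P) (col i W).
by rewrite !col_orthonormal // !eqxx /= mulr1n; lra.
Qed.

Lemma contraction_svd m n (P : 'M[R]_m) (W : 'M[R]_(n, m)) (g : 'rV[R]_m) :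
  P^T *m P = 1%:M -> W^T *m W = 1%:M -> (forall i, 0 <= g 0 i <= 1) ->
  contraction (P *m diag_mx g *m W^T).
Proof.
move=> PP WW g1 u v; rewrite mul_diag_expand mdot_suml.
apply: (@le_trans _ _
  (\sum_i (mdot (col i P) u ^+ 2 + mdot (col i W) v ^+ 2) / 2)).
  apply: ler_sum => i _; rewrite mdotZl mdot_rank1 -mulmxA.
  rewrite trmx_mul_cV mul_mx_scalar mdotZl; set a := mdot _ _; set b := mdot _ _.
  have /andP[g0 g_1] := g1 i.
  have ab : `|b * a| <= (b ^+ 2 + a ^+ 2) / 2.
    rewrite ler_norml; apply/andP; split; rewrite -subr_ge0.
      by have := sqr_ge0 (a + b); rewrite !expr2; lra.
    by have := sqr_ge0 (a - b); rewrite !expr2; lra.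
  apply: (le_trans _ ab); apply: le_trans (ler_norm _) _.
  by rewrite normrM (ger0_norm g0) (mulrC a) ler_piMl.
rewrite -mulr_suml big_split /= ler_pM2r ?invr_gt0 //.
by apply: lerD; exact: bessel.
Qed.

Lemma nuclear_norm_attained m n (X : 'M[R]_(m, n)) : (m <= n)%N ->
  exists2 Z, contraction Z & nuclear_norm X = mdot Z X.
Proof.
move=> mn; have [P [W [s [PP WW -> s0]]]] := svd_exists X mn.
exists (P *m diag_mx (const_mx 1) *m W^T).
  by apply: contraction_svd => // i; rewrite mxE ler01 lexx.
rewrite nuclear_norm_svd // -!mulmxA mdot_mull (mulmxA P^T) PP mul1mx.
rewrite diag_const_mx mul1mx -(trmxK (diag_mx s *m W^T)) mdot_tr.
rewrite trmx_mul trmxK tr_diag_mx mdotC mdot_mull WW.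
by rewrite /mdot tr_diag_mx mulmx1 mxtrace_diag.
Qed.

Lemma nuclear_normD m n (X Y : 'M[R]_(m, n)) : (m <= n)%N ->
  nuclear_norm (X + Y) <= nuclear_norm X + nuclear_norm Y.
Proof.
move=> mn; have [Z Z1 ->] := nuclear_norm_attained (X + Y) mn.
by rewrite mdotDr lerD // contraction_le_nuclear_norm.
Qed.

Lemma nuclear_normZ m n (X : 'M[R]_(m, n)) t : (m <= n)%N -> 0 <= t ->
  nuclear_norm (t *: X) = t * nuclear_norm X.
Proof.
move=> mn t0; have [P [W [s [PP WW -> s0]]]] := svd_exists X mn.
have -> : t *: (P *m diag_mx s *m W^T) = P *m diag_mx (t *: s) *m W^T.
  by rewrite linearZ /= -scalemxAr -scalemxAl.
rewrite !nuclear_norm_svd // => [|i]; last by rewrite mxE mulr_ge0.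
by rewrite mulr_sumr; apply: eq_bigr => i _; rewrite mxE.
Qed.

Lemma contraction_mulmx m n k (Z : 'M[R]_(m, n)) (A : 'M[R]_(m, k))
    (B : 'M[R]_(n, k)) : contraction Z ->
  mdot Z (A *m B^T) <= (mdot A A + mdot B B) / 2.
Proof.
move=> Z1.
have sq p (C : 'M[R]_(p, k)) : mdot C C = \sum_l mdot (col l C) (col l C).
  rewrite mdotE exchange_big; apply: eq_bigr => l _; rewrite mdotE.
  by apply: eq_bigr => i _; rewrite big_ord1 !mxE.
have -> : A *m B^T = \sum_l col l A *m (col l B)^T.
  apply/matrixP => i j; rewrite !mxE summxE; apply: eq_bigr => l _.
  by rewrite !mxE big_ord1 !mxE.
rewrite mdot_sumr !sq -big_split mulr_suml.
by apply: ler_sum => l _; exact: Z1.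
Qed.

End NuclearNorm.

(** * Optimality conditions for the regularized function *)

Section Optimality.
Context {R : realType}.

(** Equality in the defining inequality of a contraction is a maximum over
    u, so the first-order term in u vanishes. *)
Lemma contraction_attained m n (Z : 'M[R]_(m, n)) (u : 'cV[R]_m) (v : 'cV[R]_n) :
  contraction Z -> mdot Z (u *m v^T) = (mdot u u + mdot v v) / 2 ->
  Z *m v = u.
Proof.
move=> Z1 Zuv; apply/eqP; rewrite -subr_eq0; apply/eqP/mdot_eq0.
have [x xE] : exists x, x = Z *m v - u by eexists.
rewrite -xE; apply/eqP; rewrite -oppr_eq0; apply/eqP.
apply: (@linear_term_eq0 _ _ (mdot x x)) => t.
have := Z1 (u + t *: x) v.
rewrite mulmxDl -scalemxAl !mdotDr !mdotDl !mdotZr !mdotZl Zuv.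
rewrite mdot_rank1 (mdotC x u).
have -> : mdot x x = mdot (Z *m v) x - mdot u x by rewrite {1}xE mdotBl.
by rewrite expr2; lra.
Qed.

Lemma contraction_trmx m n (Z : 'M[R]_(m, n)) : contraction Z -> contraction Z^T.
Proof.
move=> Z1 u v; have := Z1 v u.
by rewrite -mdot_tr trmx_mul trmxK addrC.
Qed.

Lemma nuclear_norm_rank1 m n (u : 'cV[R]_m) (v : 'cV[R]_n) : (m <= n)%N ->
  nuclear_norm (u *m v^T) <= (mdot u u + mdot v v) / 2.
Proof. by move=> mn; have [Z Z1 ->] := nuclear_norm_attained (u *m v^T) mn. Qed.

Lemma ge0_of_small_perturbation (a b : R) :
  (forall t, 0 < t <= 1 -> 0 <= a + t * b) -> 0 <= a.
Proof.
move=> h; rewrite leNgt; apply/negP => a0.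
have b0 : 0 < b by have := h 1; rewrite ltr01 lexx => /(_ isT); lra.
have nz : 2 * (b - a) != 0 by rewrite gt_eqF //; lra.
have := h (- a / (2 * (b - a))).
have -> : a + - a / (2 * (b - a)) * b = a * ((b - 2 * a) / (2 * (b - a))).
  by field; move: nz; rewrite mulf_eq0 negb_or => /andP[].
rewrite divr_gt0 ?ler_pdivrMr /=; [|lra..].
rewrite mul1r nmulr_rge0 // => /(_ ltac:(lra)).
by rewrite leNgt divr_gt0 //; lra.
Qed.

(** Moving from X by a small multiple of H bounds - <G, H> by lambda times
    the nuclear norm of H; moving from X towards 0 gives the matching equality
    for H = X. *)
Lemma minimizer_subgradient m n (lambda : R) (h : 'M[R]_(m, n) -> R) X G L :
  (m <= n)%N -> 0 < lambda ->
  (forall H, h (X + H) <= h X + mdot G H + L / 2 * mdot H H) ->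
  global_minimizer (regularized lambda h) X ->
  contraction (- lambda^-1 *: G) /\ mdot (- G) X = lambda * nuclear_norm X.
Proof.
move=> mn l0 hup Xmin.
have sub H : - mdot G H <= lambda * nuclear_norm H.
  rewrite -subr_ge0 opprK addrC.
  apply: (@ge0_of_small_perturbation _ (L / 2 * mdot H H)) => t /andP[t0 _].
  have := Xmin (X + t *: H); rewrite /regularized => Hm.
  have := hup (t *: H); rewrite mdotZr mdotZl mdotZr => Hu.
  have Hn : lambda * nuclear_norm (X + t *: H) <=
            lambda * (nuclear_norm X + t * nuclear_norm H).
    rewrite -(nuclear_normZ H mn (ltW t0)); apply: ler_wpM2l; first exact: ltW.
    exact: nuclear_normD.
  rewrite -(pmulr_rge0 _ t0); rewrite mulrDr in Hn.
  have -> : t * (mdot G H + lambda * nuclear_norm H + t * (L / 2 * mdot H H)) =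
      t * mdot G H + L / 2 * (t * (t * mdot H H)) +
      lambda * (t * nuclear_norm H) by ring.
  by lra.
split.
  move=> u v; rewrite mdotZl mulNr -mulrN ler_pdivrMl //.
  apply: le_trans (sub _) _; rewrite ler_pM2l //.
  exact: nuclear_norm_rank1.
apply/eqP; rewrite mdotNl eq_le sub /= -subr_ge0.
apply: (@ge0_of_small_perturbation _ (L / 2 * mdot X X)) => t /andP[t0 t1].
have := Xmin (X + (- t) *: X); rewrite /regularized => Hm.
have := hup ((- t) *: X); rewrite mdotZr mdotZl mdotZr => Hu.
have XE : X + - t *: X = (1 - t) *: X by rewrite scalerBl scale1r scaleNr.
have t1' : 0 <= 1 - t by lra.
rewrite {2}XE nuclear_normZ // in Hm.
rewrite -(pmulr_rge0 _ t0).
have -> : t * (- mdot G X - lambda * nuclear_norm X + t * (L / 2 * mdot X X)) =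
    - t * mdot G X + L / 2 * (- t * (- t * mdot X X)) -
    lambda * (t * nuclear_norm X) by ring.
by lra.
Qed.

(** The converse direction, with the quadratic gain of strong convexity kept:
    it yields uniqueness of the minimizer as well. *)
Lemma subgradient_minimizer m n (lambda : R) (h : 'M[R]_(m, n) -> R) X G mu :
  (m <= n)%N -> 0 < lambda ->
  (forall Y, h X + mdot G (Y - X) + mu / 2 * mdot (Y - X) (Y - X) <= h Y) ->
  contraction (- lambda^-1 *: G) -> mdot (- G) X = lambda * nuclear_norm X ->
  forall Y, regularized lambda h X + mu / 2 * mdot (Y - X) (Y - X)
            <= regularized lambda h Y.
Proof.
move=> mn l0 hlow G1 GX Y; rewrite /regularized.
have := hlow Y; have := contraction_le_nuclear_norm Y mn G1.
rewrite mdotZl mulNr -mulrN ler_pdivrMl //.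
by move: GX; rewrite mdotNl mdotBr; lra.
Qed.

(** Since Z / lambda is a contraction attaining the nuclear norm of X, it maps
    each right singular vector of X with positive singular value to the left
    one.  Distributing the square roots of the singular values on both sides
    makes X a product U V^T satisfying the equations of balanced_joint_svd. *)
Lemma minimizer_joint_svd m n (lambda : R) (X Z : 'M[R]_(m, n)) :
  (m <= n)%N -> 0 < lambda -> contraction (lambda^-1 *: Z) ->
  mdot Z X = lambda * nuclear_norm X ->
  exists (P : 'M[R]_m) (W : 'M[R]_(n, m)) (s g : 'rV[R]_m),
    [/\ P^T *m P = 1%:M, W^T *m W = 1%:M, X = P *m diag_mx s *m W^T,
        Z = P *m diag_mx g *m W^T
      & forall i, [/\ 0 <= s 0 i, 0 <= g 0 i & 0 < s 0 i -> g 0 i = lambda]].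
Proof.
move=> mn l0; have [P [W [s [PP WW -> s0]]]] := svd_exists X mn.
have lN : lambda != 0 by rewrite gt_eqF.
rewrite nuclear_norm_svd // {1}mul_diag_expand mdot_sumr mulr_sumr => Z1 ZX.
have le1 i : mdot Z (col i P *m (col i W)^T) <= lambda.
  have := Z1 (col i P) (col i W).
  rewrite !col_orthonormal // eqxx mdotZl ler_pdivrMl // mulr1n; lra.
have sat i : 0 < s 0 i -> mdot Z (col i P *m (col i W)^T) = lambda.
  move=> si; apply/eqP; rewrite eq_le le1 /= -(ler_pM2l si) -subr_le0.
  have /eqP : \sum_j s 0 j * (lambda - mdot Z (col j P *m (col j W)^T)) = 0.
    under eq_bigr do rewrite mulrBr mulrC -mdotZr.
    by rewrite sumrB ZX subrr.
  rewrite psumr_eq0 => [/allP/(_ i)|j _]; last by rewrite mulr_ge0 // subr_ge0.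
  by rewrite mem_index_enum => /(_ isT)/eqP; rewrite mulrBr => ->.
pose q : 'rV[R]_m := \row_i Num.sqrt (s 0 i).
have qq : diag_mx q *m diag_mx q = diag_mx s.
  rewrite mulmx_diag; congr diag_mx; apply/rowP => i.
  by rewrite !mxE -expr2 sqr_sqrtr.
have -> : P *m diag_mx s *m W^T = (P *m diag_mx q) *m (W *m diag_mx q)^T.
  by rewrite trmx_mul tr_diag_mx -!mulmxA (mulmxA (diag_mx q)) qq.
have colsE p r (A : 'M[R]_(p, r)) (B : 'M[R]_(p, m)) (C : 'M[R]_(r, m)) :
    (forall i, 0 < s 0 i -> A *m col i C = lambda *: col i B) ->
    A *m (C *m diag_mx q) = lambda *: (B *m diag_mx q).
  move=> AC; rewrite mulmxA; apply/matrixP => i j; rewrite !mul_mx_diag !mxE.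
  have [sj|] := ltP 0 (s 0 j); last first.
    by move=> sj; rewrite ler0_sqrtr // !mulr0.
  have /matrixP/(_ i 0) := AC j sj; rewrite !colE mulmxA -!colE !mxE => ->.
  by rewrite mulrA.
apply: balanced_joint_svd => //; apply: colsE => i si.
  apply: (scalerI (invr_neq0 lN)); rewrite scalerA mulVf // scale1r scalemxAl.
  apply: contraction_attained => //.
  by rewrite mdotZl sat // mulVf // !col_orthonormal // eqxx mulr1n; lra.
apply: (scalerI (invr_neq0 lN)); rewrite scalerA mulVf // scale1r scalemxAl.
rewrite -linearZ; apply: contraction_attained; first exact: contraction_trmx.
rewrite -mdot_tr trmx_mul !trmxK mdotZl sat // mulVf //.
by rewrite !col_orthonormal // eqxx mulr1n; lra.
Qed.

End Optimality.

(** * Taylor bounds and cocoercivity *)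

Section Taylor.
Context {R : realType}.

(** Lines of the space of factors are mapped by the product U V^T to
    parabolas, whence this form of the chain rule. *)
Lemma is_derive_along_parabola (V : normedModType R) (h : V -> R) (x K C : V)
    (t : R) : differentiable h (x + t *: K + t ^+ 2 *: C) ->
  is_derive t 1 (fun s => h (x + s *: K + s ^+ 2 *: C))
    ('D_(K + (2 * t) *: C) h (x + t *: K + t ^+ 2 *: C)).
Proof.
move=> dh; pose g (s : R) := x + s *: K + s ^+ 2 *: C.
have dg : is_diff t g (fun s => s *: (K + (2 * t) *: C)).
  have d2 : is_derive t (1 : R) (fun s : R => s ^+ 2) (2 * t).
    apply: DeriveDef; first exact: exprn_derivable.
    by rewrite exp_derive expr1 [LHS]mulr1.
  have dd2 : differentiable (fun s : R => s ^+ 2) t.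
    by apply/derivable1_diffP; exact: ex_derive.
  have i2 : is_diff t (fun s : R => s ^+ 2 *: C) (fun s => (s * (2 * t)) *: C).
    apply: DiffDef; first exact: differentiableZl.
    rewrite diffZl //; apply/funext => s; congr (_ *: _).
    by rewrite diff1E // derive1E derive_val.
  have := is_diffD (is_diffD (is_diff_cst x t) (is_diff_scalel t K)) i2.
  rewrite [X in is_diff _ _ X](_ : _ = fun s => s *: (K + (2 * t) *: C)) //.
  by apply/funext => s; rewrite !fctE add0r scalerDr scalerA.
apply: DeriveDef.
  apply/derivable1_diffP; apply: differentiable_comp => //; exact: ex_diff.
have -> : (fun s => h (x + s *: K + s ^+ 2 *: C)) = h \o g by [].
rewrite deriveE; last by apply: differentiable_comp => //; exact: ex_diff.
rewrite diff_comp //= ?diff_val ?scale1r ?deriveE //; exact: ex_diff.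
Qed.

Lemma is_derive_along_line (V : normedModType R) (h : V -> R) (x K : V)
    (t : R) : differentiable h (x + t *: K) ->
  is_derive t 1 (fun s => h (x + s *: K)) ('D_K h (x + t *: K)).
Proof.
have := @is_derive_along_parabola _ h x K 0 t.
rewrite !scaler0 !addr0.
by under [X in is_derive _ _ X]funext do rewrite scaler0 addr0.
Qed.

(** Two applications of the mean value theorem, to dp and then to p minus its
    quadratic lower model. *)
Lemma taylor_lower (p dp ddp : R -> R) c :
  (forall t : R, is_derive t 1 p (dp t)) ->
  (forall t : R, is_derive t 1 dp (ddp t)) ->
  (forall t, c <= ddp t) -> p 0 + dp 0 + c / 2 <= p 1.
Proof.
move=> d1 d2 cdd.
have cont (f df : R -> R) a b : (forall t : R, is_derive t 1 f (df t)) ->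
    {within `[a, b], continuous f}.
  move=> fd; apply: derivable_within_continuous => t _; exact: ex_derive.
have dpt t : 0 <= t -> c * t <= dp t - dp 0.
  move=> t0; have [s _ ->] := @MVT_segment R dp ddp 0 t t0 (fun x _ => d2 x)
    (cont _ _ _ _ d2).
  by rewrite subr0 ler_wpM2r.
pose g t := p t - (dp 0 * t + c / 2 * t ^+ 2).
have dg t : is_derive t (1 : R) g (dp t - (dp 0 + c * t)).
  have h1 := d1 t.
  rewrite /g; apply: is_derive_eq.
  by rewrite /GRing.scale /=; field.
have [s] := @MVT_segment R g _ 0 1 ler01 (fun x _ => dg x) (cont _ _ _ _ dg).
rewrite in_itv /= => /andP[s0 _]; have := dpt s s0; rewrite /g; lra.
Qed.

Definition gradient m n (h : 'M[R]_(m, n) -> R) X : 'M[R]_(m, n) :=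
  \matrix_(i, j) 'D_(delta_mx i j) h X.

Lemma derive_gradient m n (h : 'M[R]_(m, n) -> R) X H :
  differentiable h X -> 'D_H h X = mdot (gradient h X) H.
Proof.
move=> dh; rewrite deriveE // [in LHS](matrix_sum_delta H) linear_sum mdotE.
apply: eq_bigr => i _; rewrite linear_sum; apply: eq_bigr => j _.
by rewrite linearZ /= mxE deriveE // mulrC.
Qed.

Lemma taylor_lower_mx m n (h : 'M[R]_(m, n) -> R) mu : C2 h ->
  (forall X H, mu * mdot H H <= hessian h X H) ->
  forall X H, h X + mdot (gradient h X) H + mu / 2 * mdot H H <= h (X + H).
Proof.
move=> [dh ddh _] hmu X H.
have := @taylor_lower (fun s => h (X + s *: H)) (fun s => 'D_H h (X + s *: H))
  (fun s => hessian h (X + s *: H) H) (mu * mdot H H).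
rewrite /= !scale0r !addr0 !scale1r -derive_gradient // [mu / 2 * _]mulrAC.
apply=> t; [exact: is_derive_along_line|exact: is_derive_along_line|].
exact: hmu.
Qed.

Lemma taylor_upper_mx m n (h : 'M[R]_(m, n) -> R) L : C2 h ->
  (forall X H, hessian h X H <= L * mdot H H) ->
  forall X H, h (X + H) <= h X + mdot (gradient h X) H + L / 2 * mdot H H.
Proof.
move=> [dh ddh _] hL X H.
have := @taylor_lower (fun s => - h (X + s *: H)) (fun s => - 'D_H h (X + s *: H))
  (fun s => - hessian h (X + s *: H) H) (- (L * mdot H H)).
rewrite /= !scale0r !addr0 !scale1r -derive_gradient // => taylor.
suff : - h X - 'D_H h X + - (L * mdot H H) / 2 <= - h (X + H) by lra.
apply: taylor => t; last by rewrite lerN2.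
- by apply: is_deriveN; exact: is_derive_along_line.
- by apply: is_deriveN; exact: is_derive_along_line.
Qed.

(** The lower bound from X and the upper bound from Y are compared at the
    common point Y + w, and symmetrically at X - w; adding the two and choosing
    w proportional to E - mu D gives the claim.  When L = mu the bounds hold for every multiple of
    E - mu D, which must then vanish. *)
Lemma cocoercivity m n (h : 'M[R]_(m, n) -> R) (G : 'M[R]_(m, n) -> 'M[R]_(m, n))
    mu L : mu <= L ->
  (forall X H, h X + mdot (G X) H + mu / 2 * mdot H H <= h (X + H)
               <= h X + mdot (G X) H + L / 2 * mdot H H) ->
  forall X Y D E, D = X - Y -> E = G X - G Y ->
    0 <= mdot (E - mu *: D) (L *: D - E).
Proof.
move=> muL hb X Y D E DE EE.
have [F FE] : exists F, F = E - mu *: D by eexists.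
have key w : 2 * mdot F w <= mdot F D + (L - mu) * mdot w w.
  have /andP[h1 _] := hb X (w - D).
  have /andP[_ h2] := hb Y w.
  have /andP[h3 _] := hb Y (D - w).
  have /andP[_ h4] := hb X (- w).
  have e1 : X + (w - D) = Y + w.
    by rewrite DE; apply/matrixP => i j; rewrite !mxE; ring.
  have e2 : Y + (D - w) = X - w.
    by rewrite DE; apply/matrixP => i j; rewrite !mxE; ring.
  rewrite e1 in h1; rewrite e2 in h3.
  move: h1 h2 h3 h4.
  rewrite FE EE !(mdotBl, mdotBr, mdotNl, mdotNr, mdotZl, mdotZr).
  rewrite (mdotC w D); lra.
rewrite -FE.
have -> : L *: D - E = (L - mu) *: D - F.
  by rewrite FE; apply/matrixP => i j; rewrite !mxE; ring.
have [Lmu|Lmu] := eqVneq L mu.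
  have F0 : F = 0; last by rewrite F0 mdot0l.
  apply: mdot_eq0; apply/eqP; rewrite eq_le mdot_ge0 andbT leNgt.
  apply/negP => FF; have := key (((mdot F D + 1) / mdot F F) *: F).
  rewrite mdotZr Lmu subrr mul0r divfK ?gt_eqF // => h1.
  by have := key 0; rewrite !mdot0r; lra.
have Lp : 0 < L - mu by rewrite subr_gt0 lt_neqAle eq_sym Lmu.
have := key ((L - mu)^-1 *: F); rewrite !(mdotZr, mdotZl).
rewrite [_ * (_^-1 * (_ * _))]mulrA mulfV ?gt_eqF // mul1r => h1.
rewrite mdotBr mdotZr subr_ge0 -ler_pdivrMl //; lra.
Qed.

End Taylor.

(** * Derivatives of the factored function *)

Section FactoredDerivatives.
Context {R : realType}.

(** Both sides are the limit of the same difference quotient. *)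
Lemma derive_on_line (V : normedModType R) (F : V -> R) (z H : V) (t : R) :
  'D_H F (z + t *: H) = 'D_1 (fun s : R => F (z + s *: H)) t.
Proof.
rewrite /derive; set g1 := fun s => _; set g2 := fun s => _.
suff -> : g1 = g2 by []; apply/funext => s; rewrite /g1 /g2 /=.
by rewrite [s%:A]mulr1 scalerDl addrCA.
Qed.

Context (m n r : nat) (lambda : R) (h : 'M[R]_(m, n) -> R) (hC2 : C2 h).
Implicit Types (U A : 'M[R]_(m, r)) (V B : 'M[R]_(n, r)).

Lemma factored_on_line U V A B (s : R) :
  factored lambda h ((U, V) + s *: (A, B)) =
  h (U *m V^T + s *: (A *m V^T + U *m B^T) + s ^+ 2 *: (A *m B^T)) +
  (lambda / 2 * (mdot U U + mdot V V) + s * (lambda * (mdot U A + mdot V B)) +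
   s ^+ 2 * (lambda / 2 * (mdot A A + mdot B B))).
Proof.
rewrite /factored /= !frobenius_normE; congr (h _ + _).
  rewrite linearD linearZ /= mulmxDl !mulmxDr -!scalemxAl -!scalemxAr scalerA.
  by rewrite -expr2 scalerDr !addrA; congr (_ + _); rewrite addrAC.
by rewrite !(mdotDl, mdotDr, mdotZl, mdotZr) (mdotC A U) (mdotC B V); field.
Qed.

Lemma is_derive_factored_on_line U V A B (s : R) :
  is_derive s 1 (fun s => factored lambda h ((U, V) + s *: (A, B)))
   ('D_(A *m V^T + U *m B^T) h
      (U *m V^T + s *: (A *m V^T + U *m B^T) + s ^+ 2 *: (A *m B^T)) +
    2 * (s * 'D_(A *m B^T) h
      (U *m V^T + s *: (A *m V^T + U *m B^T) + s ^+ 2 *: (A *m B^T))) +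
    (lambda * (mdot U A + mdot V B) + s * (lambda * (mdot A A + mdot B B)))).
Proof.
have [dh _ _] := hC2.
have d1 := is_derive_along_parabola (dh (U *m V^T +
  s *: (A *m V^T + U *m B^T) + s ^+ 2 *: (A *m B^T))).
have d2 (a b c : R) : is_derive s (1 : R) (fun t => a + t * b + t ^+ 2 * c)
    (b + 2 * s * c).
  by apply: is_derive_eq; rewrite /GRing.scale /=; ring.
have -> : (fun t : R => factored lambda h ((U, V) + t *: (A, B))) =
    (fun t => h (U *m V^T + t *: (A *m V^T + U *m B^T) + t ^+ 2 *: (A *m B^T))) +
    (fun t => lambda / 2 * (mdot U U + mdot V V) +
              t * (lambda * (mdot U A + mdot V B)) +
              t ^+ 2 * (lambda / 2 * (mdot A A + mdot B B))).
  by apply/funext => t; exact: factored_on_line.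
apply: (@is_derive_eq _ _ _ _ _ _ _ _ (is_deriveD d1 (d2 _ _ _))).
rewrite derive_gradient // mdotDr mdotZr -!derive_gradient // mulrA.
by congr (_ + _); field.
Qed.

Lemma derive_factored U V A B :
  'D_(A, B) (factored lambda h (r := r)) (U, V) =
  mdot (gradient h (U *m V^T)) (A *m V^T + U *m B^T) +
  lambda * (mdot U A + mdot V B).
Proof.
have [dh _ _] := hC2.
have := derive_on_line (factored lambda h (r := r)) (U, V) (A, B) 0.
rewrite scale0r addr0 => ->.
have := is_derive_factored_on_line U V A B 0.
move=> d; rewrite derive_val; rewrite expr0n !scale0r !addr0 !mul0r mulr0 !addr0.
by rewrite derive_gradient.
Qed.

(** The first derivative along (A, B) contains the direction
    A V^T + U B^T, which itself moves when the base point moves along (A, B);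
    this produces the first-order term in A B^T. *)
Lemma hessian_factored U V A B :
  hessian (factored lambda h (r := r)) (U, V) (A, B) =
  hessian h (U *m V^T) (A *m V^T + U *m B^T) +
  2 * mdot (gradient h (U *m V^T)) (A *m B^T) +
  lambda * (mdot A A + mdot B B).
Proof.
have [dh ddh _] := hC2; rewrite /hessian.
have := derive_on_line ('D_(A, B) (factored lambda h (r := r))) (U, V) (A, B) 0.
rewrite scale0r addr0 => ->.
set K := A *m V^T + U *m B^T; set C := A *m B^T; set X := U *m V^T.
have -> : (fun s : R =>
      'D_(A, B) (factored lambda h (r := r)) ((U, V) + s *: (A, B))) =
    (fun s => 'D_K h (X + s *: K + s ^+ 2 *: C)) +
    (fun s => 2 * (s * 'D_C h (X + s *: K + s ^+ 2 *: C)) +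
    (lambda * (mdot U A + mdot V B) + s * (lambda * (mdot A A + mdot B B)))).
  apply/funext => s; rewrite derive_on_line.
  rewrite (@derive_val _ _ _ _ _ _ _ (is_derive_factored_on_line U V A B s)).
  by rewrite -addrA.
have d1 : is_derive (0 : R) (1 : R) (fun s => 'D_K h (X + s *: K + s ^+ 2 *: C))
    ('D_K ('D_K h) X).
  have := is_derive_along_parabola (ddh K (X + (0 : R) *: K + 0 ^+ 2 *: C)).
  by rewrite expr0n mulr0 !scale0r !addr0.
have d2 : is_derive (0 : R) (1 : R) (fun s => 'D_C h (X + s *: K + s ^+ 2 *: C))
    ('D_K ('D_C h) X).
  have := is_derive_along_parabola (ddh C (X + (0 : R) *: K + 0 ^+ 2 *: C)).
  by rewrite expr0n mulr0 !scale0r !addr0.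
apply: derive_val; apply: is_derive_eq.
rewrite expr0n /= !scale0r !addr0 !add0r (derive_gradient C (dh X)).
by rewrite /GRing.scale /=; ring.
Qed.

End FactoredDerivatives.

(** * Second-order stationary points *)

Section StationaryPoints.
Context {R : realType}.

Lemma exists_kernel_vector m k (U : 'M[R]_(m, k)) : (\rank U < k)%N ->
  exists2 q : 'cV[R]_k, q != 0 & U *m q = 0.
Proof.
move=> rU; have : ~~ row_free U^T by rewrite /row_free mxrank_tr neq_ltn rU.
rewrite -kermx_eq0 => /rowV0Pn[q /sub_kermxP qU q0]; exists q^T.
  by rewrite trmx_eq0.
by apply: trmx_inj; rewrite trmx_mul trmxK trmx0.
Qed.

Lemma stationary_gradient m n r (lambda : R) (h : 'M[R]_(m, n) -> R)
    (U : 'M[R]_(m, r)) (V : 'M[R]_(n, r)) : C2 h ->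
  (forall H, 'D_H (factored lambda h (r := r)) (U, V) = 0) <->
  - gradient h (U *m V^T) *m V = lambda *: U /\
  (- gradient h (U *m V^T))^T *m U = lambda *: V.
Proof.
move=> hC2; set G := gradient h (U *m V^T).
have dE A B : 'D_(A, B) (factored lambda h (r := r)) (U, V) =
    mdot A (G *m V + lambda *: U) + mdot B (G^T *m U + lambda *: V).
  have e1 : mdot G (A *m V^T) = mdot A (G *m V).
    by rewrite mdotC mdot_mulr trmxK.
  have e2 : mdot G (U *m B^T) = mdot B (G^T *m U).
    by rewrite mdotC mdot_mull -mdot_tr trmxK trmx_mul trmxK.
  rewrite derive_factored // -/G !mdotDr !mdotZr e1 e2 (mdotC U) (mdotC V); ring.
split=> [st|[ZV ZU] [A B]].
  have z0 A B :
      mdot A (G *m V + lambda *: U) + mdot B (G^T *m U + lambda *: V) = 0.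
    by rewrite -dE st.
  split; apply/eqP; rewrite -subr_eq0 -oppr_eq0; apply/eqP/mdot_eq0.
    rewrite mulNmx -opprD opprK.
    by have := z0 (G *m V + lambda *: U) 0; rewrite mdot0l addr0.
  rewrite linearN mulNmx -opprD opprK.
  by have := z0 0 (G^T *m U + lambda *: V); rewrite mdot0l add0r.
rewrite dE -ZV -ZU linearN !mulNmx !subrr !mdot0r addr0 //.
Qed.

(** A common kernel vector q of U and V makes the directions p q^T and w q^T
    invisible to the product U V^T at first order, so only the indefinite term
    <gradient, A B^T> and the regularizer remain in the Hessian. *)
Lemma rank_deficient_optimality m n r (lambda : R) (h : 'M[R]_(m, n) -> R)
    (U : 'M[R]_(m, r)) (V : 'M[R]_(n, r)) (p : 'cV[R]_m) (w : 'cV[R]_n) (g : R) :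
  0 < lambda -> C2 h ->
  second_order_stationary (factored lambda h (r := r)) (U, V) ->
  mdot p p = 1 -> mdot w w = 1 -> - gradient h (U *m V^T) *m w = g *: p ->
  (\rank U < r)%N -> g <= lambda.
Proof.
move=> l0 hC2 [/(stationary_gradient _ _ _ hC2)[ZV ZU] so] pp ww Zw.
move=> /exists_kernel_vector[q q0 Uq].
have Vq : V *m q = 0.
  apply: (scalerI (lt0r_neq0 l0)).
  by rewrite scalemxAl -ZU -mulmxA Uq mulmx0 scaler0.
have qq := mdot_gt0 q0.
have := so (p *m q^T, w *m q^T).
rewrite hessian_factored // !trmx_mul !trmxK !mulmxA -(mulmxA p) -trmx_mul Vq.
rewrite Uq trmx0 !mulmx0 mul0mx addr0.
have -> : hessian h (U *m V^T) 0 = 0.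
  rewrite /hessian; have [_ ddh _] := hC2.
  by rewrite deriveE // linear0.
have -> : p *m q^T *m q *m w^T = mdot q q *: (p *m w^T).
  by rewrite -(mulmxA p) trmx_mul_cV mul_mx_scalar -scalemxAl.
rewrite mdotZr mdot_rank1.
have -> : gradient h (U *m V^T) *m w = - (g *: p) by rewrite -Zw mulNmx opprK.
rewrite mdotNl mdotZl pp !mdot_rank1_rank1 pp ww.
have -> : 0 + 2 * (mdot q q * - (g * 1)) + lambda * (1 * mdot q q + 1 * mdot q q)
  = 2 * mdot q q * (lambda - g) by ring.
by rewrite pmulr_rge0 ?mulr_gt0 // subr_ge0.
Qed.

(** The directions A = p' x^T and B = w' x^T with x = U^T p exchange the
    singular pair (p, w) of X, of value s, for the pair (p', w'); the change
    A V^T + U B^T = s (p' w^T + p w'^T) has squared norm 2 s^2. *)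
Lemma cross_direction_bound m n r (lambda L : R) (h : 'M[R]_(m, n) -> R)
    (U : 'M[R]_(m, r)) (V : 'M[R]_(n, r)) (p p' : 'cV[R]_m) (w w' : 'cV[R]_n)
    (s g : R) :
  0 < lambda -> C2 h ->
  (forall X H, hessian h X H <= L * mdot H H) ->
  second_order_stationary (factored lambda h (r := r)) (U, V) ->
  mdot p p = 1 -> mdot w w = 1 -> mdot p' p' = 1 -> mdot w' w' = 1 ->
  mdot p p' = 0 -> mdot w w' = 0 -> 0 < s ->
  U *m V^T *m w = s *: p -> (U *m V^T)^T *m p = s *: w ->
  - gradient h (U *m V^T) *m w = lambda *: p ->
  - gradient h (U *m V^T) *m w' = g *: p' ->
  g <= lambda + L * s.
Proof.
move=> l0 hC2 hL [/(stationary_gradient _ _ _ hC2)[ZV ZU] so].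
move=> pp ww pp' ww' p0 w0 s0 Xw Xp Zw Zw'.
have lN := lt0r_neq0 l0.
set x := U^T *m p.
have xE : x = V^T *m w.
  apply: (scalerI lN); rewrite /x scalemxAr -Zw mulmxA.
  rewrite -[_ *m - _]trmxK trmx_mul trmxK ZU linearZ /=.
  by rewrite scalemxAl.
have Vx : V *m x = s *: w by rewrite /x mulmxA -Xp trmx_mul trmxK.
have Ux : U *m x = s *: p by rewrite xE mulmxA.
have xx : mdot x x = s by rewrite {1}/x mdot_mull trmxK Ux mdotZr pp mulr1.
have := so (p' *m x^T, w' *m x^T).
rewrite hessian_factored // => so1.
have KE : p' *m x^T *m V^T + U *m (w' *m x^T)^T = s *: (p' *m w^T + p *m w'^T).
  rewrite scalerDr; congr (_ + _).
    by rewrite -mulmxA -trmx_mul Vx linearZ /= -scalemxAr.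
  by rewrite trmx_mul trmxK mulmxA Ux -scalemxAl.
have CE : p' *m x^T *m (w' *m x^T)^T = s *: (p' *m w'^T).
  rewrite (trmx_mul w' x^T) trmxK mulmxA -(mulmxA p') trmx_mul_cV xx.
  by rewrite mul_mx_scalar -scalemxAl.
have := hL (U *m V^T) (p' *m x^T *m V^T + U *m (w' *m x^T)^T).
move: so1; rewrite KE CE.
rewrite mdotZr mdot_rank1.
have -> : gradient h (U *m V^T) *m w' = - (g *: p') by rewrite -Zw' mulNmx opprK.
rewrite mdotNl mdotZl pp' !mdotZl !mdotZr !mdotDl !mdotDr !mdot_rank1_rank1.
rewrite pp ww pp' ww' (mdotC p' p) p0 (mdotC w' w) w0 xx => so1 so2.
have : 0 <= 2 * s * (lambda + L * s - g) by lra.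
by rewrite pmulr_rge0 ?mulr_gt0 // subr_ge0.
Qed.

End StationaryPoints.

(** * Misalignment of two singular bases *)

Section Misalignment.
Context {R : realType}.

(** The missing row and column masses are distributed as a product measure.
    If the total missing mass tau is 0, so are all of them, and the convention
    x / 0 = 0 is harmless. *)
Lemma doubly_stochastic_completion m (S : 'I_m -> 'I_m -> R) :
  (forall i j, 0 <= S i j) -> (forall i, \sum_j S i j <= 1) ->
  (forall j, \sum_i S i j <= 1) ->
  exists T : 'I_m -> 'I_m -> R,
    [/\ forall i j, S i j <= T i j, forall i, \sum_j T i j = 1
      & forall j, \sum_i T i j = 1].
Proof.
move=> S0 rS cS.
pose rho i := 1 - \sum_j S i j; pose gam j := 1 - \sum_i S i j.
pose tau := \sum_i rho i.
have tauE : tau = \sum_j gam j.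
  by rewrite /tau /rho /gam !sumrB exchange_big.
have rho0 i : 0 <= rho i by rewrite subr_ge0.
have gam0 j : 0 <= gam j by rewrite subr_ge0.
have tau0 : 0 <= tau by apply: sumr_ge0.
exists (fun i j => S i j + rho i * gam j / tau); split.
- by move=> i j; rewrite lerDl divr_ge0 // mulr_ge0.
- move=> i; rewrite big_split /= -mulr_suml -mulr_sumr -tauE.
  have [t0|t0] := eqVneq tau 0.
    rewrite t0 mulr0 mul0r addr0; apply/eqP; rewrite eq_sym -subr_eq0 -/(rho i).
    move/eqP: t0; rewrite psumr_eq0 // => /allP/(_ i).
    by rewrite mem_index_enum; apply.
  by rewrite mulfK // /rho addrC subrK.
- move=> j; rewrite big_split /= -mulr_suml -mulr_suml -/tau.
  have [t0|t0] := eqVneq tau 0.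
    rewrite t0 !mul0r addr0; apply/eqP; rewrite eq_sym -subr_eq0 -/(gam j).
    move/eqP: t0; rewrite tauE psumr_eq0 // => /allP/(_ j).
    by rewrite mem_index_enum; apply.
  by rewrite mulrAC mulfV // mul1r /gam addrC subrK.
Qed.

(** For t > 0, complete the square in y; for t <= 0 both factors are
    nonpositive. *)
Lemma mixed_block_bound (L mu t y b : R) : 0 < mu -> mu <= L -> 0 <= y ->
  t <= L * b -> 0 <= b ->
  - (L * mu * b ^+ 2 * ((L / mu - 1) ^+ 2 / 4)) <= (t - L * y) * (t - mu * y).
Proof.
move=> mu0 muL y0 tb b0; have L0 : 0 < L by lra.
have Lmu : 0 < 4 * (L * mu) by rewrite !mulr_gt0.
have [t0|t0] := leP t 0.
  apply: (@le_trans _ _ 0).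
    rewrite oppr_le0; apply: mulr_ge0; last by rewrite divr_ge0 ?sqr_ge0.
    by apply: mulr_ge0; [exact/ltW/mulr_gt0|exact: sqr_ge0].
  by rewrite mulr_le0 // subr_le0 (le_trans t0) // mulr_ge0 // ltW.
rewrite -(ler_pM2l Lmu).
have -> : 4 * (L * mu) * - (L * mu * b ^+ 2 * ((L / mu - 1) ^+ 2 / 4)) =
    - ((L - mu) ^+ 2 * (L * b) ^+ 2) by field; rewrite gt_eqF.
have -> : 4 * (L * mu) * ((t - L * y) * (t - mu * y)) =
    (2 * L * mu * y - (L + mu) * t) ^+ 2 - (L - mu) ^+ 2 * t ^+ 2 by ring.
rewrite -subr_ge0.
have -> : forall a c d : R, a ^+ 2 - c - - d = a ^+ 2 + (d - c) by move=> *; ring.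
rewrite addr_ge0 ?sqr_ge0 // -mulrBr mulr_ge0 ?sqr_ge0 // subr_ge0.
by rewrite ler_pXn2r // ?nnegrE ?ltW // (lt_le_trans t0).
Qed.

Lemma minn_sub_swap m p q : (p <= m)%N -> (q <= m)%N ->
  (minn p (m - q) + q = minn q (m - p) + p)%N.
Proof. lia. Qed.

(** An affine function of th on [0, e], nonnegative at 0 and positive at e. *)
Lemma weight_tradeoff (K e d th : R) : 0 <= th <= e -> e <= d -> K * e < d ->
  0 <= (d - e) + (1 - K) * th /\
  (0 < (d - e) + (1 - K) * th \/ (th = 0)).
Proof.
move=> /andP[th0 the] ed Ked.
have [e0|e0] := leP e 0.
  have th00 : th = 0 by apply/eqP; rewrite eq_le th0 andbT; lra.
  rewrite th00 mulr0; split; [lra|by right].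
have [t0|t0] := leP th 0.
  have th00 : th = 0 by apply/eqP; rewrite eq_le th0 t0.
  rewrite th00 mulr0; split; [lra|by right].
suff fp : 0 < (d - e) + (1 - K) * th by split; [exact: ltW|left].
rewrite -(pmulr_rgt0 _ e0).
have -> : e * (d - e + (1 - K) * th) = (d - e) * (e - th) + (d - K * e) * th by ring.
by rewrite ltr_wpDl ?mulr_ge0 ?mulr_gt0 //; lra.
Qed.

(** Here s, g are the singular values of X and Z, primes refer to X' and Z',
    and T weighs pairs of singular vectors.  The entries of each product are
    shifted by the common constant lambda, which cancels. *)
Lemma misalignment_sum_gt0 m (T : 'I_m -> 'I_m -> R) (s g s' g' : 'I_m -> R)
    (L mu lambda : R) (r rs : nat) (i0 : 'I_m) :
  0 < mu -> mu <= L ->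
  (forall i j, 0 <= T i j) -> (forall i, \sum_j T i j = 1) ->
  (forall j, \sum_i T i j = 1) ->
  (forall i, 0 <= s i) -> (forall j, 0 <= s' j) ->
  (forall i, 0 < s i -> g i = lambda) ->
  (forall j, 0 < s' j -> g' j = lambda) -> (forall j, g' j <= lambda) ->
  (forall i i', s i = 0 -> 0 < s i' -> g i <= lambda + L * s i') ->
  lambda < g i0 -> (0 < r)%N ->
  #|[pred i | 0 < s i]| = r -> #|[pred j | 0 < s' j]| = rs ->
  (rs <= r)%N ->
  (L / mu - 1) ^+ 2 / 4 * (minn rs (m - r))%:R < (minn r (m - rs))%:R ->
  0 < \sum_i \sum_j T i j * ((L * s i + g i - (L * s' j + g' j)) *
                             (mu * s i + g i - (mu * s' j + g' j))).
Proof.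
move=> mu0 muL T0 rT cT s0 s'0 gl g'l g'le gle gi0 r0 cr crs rsr cond.
have L0 : 0 < L by lra.
(* b is the smallest positive s; this is where 0 < r is needed. *)
have [b [b0 bs bg]] : exists b : R, [/\ 0 < b, forall i, 0 < s i -> b <= s i
    & forall i, s i = 0 -> g i <= lambda + L * b].
  have /card_gt0P[k sk] : (0 < #|[pred i | (0 < s i)%R]|)%N by rewrite cr.
  have [k1 sk1 kmin] := @arg_minP _ _ _ k [pred i | 0 < s i] s sk.
  by exists (s k1); split => // i si; exact: gle.
pose K := (L / mu - 1) ^+ 2 / 4; rewrite -/K in cond.
(* x and y are the indicators of the supports of s and s'. *)
pose x i : R := (0 < s i)%R%:R; pose y j : R := (0 < s' j)%R%:R.
pose t0 := g i0 - lambda.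
have t0p : 0 < t0 by rewrite subr_gt0.
have Lmb : 0 < L * mu * b ^+ 2 by rewrite mulr_gt0 ?exprn_gt0 // mulr_gt0.
(* The second summand is the extra gain of the row i0, where g exceeds lambda;
   it settles the case in which both unbalanced blocks have mass 0. *)
have bound i j : L * mu * b ^+ 2 * (x i * (1 - y j) - K * ((1 - x i) * y j)) +
    (i == i0)%:R * ((1 - y j) * t0 ^+ 2) <=
    (L * s i + g i - (L * s' j + g' j)) * (mu * s i + g i - (mu * s' j + g' j)).
  rewrite /x /y; have [si|] := ltP 0 (s i); last first.
    move=> si; have {}si : s i = 0 by apply/eqP; rewrite eq_le si s0.
    have [s'j|] := ltP 0 (s' j).
      rewrite (g'l j) // si; have := bg i si => gi.
      have := @mixed_block_bound L mu (g i - lambda) (s' j) b mu0 muL (s'0 j) _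
        (ltW b0).
      rewrite lerBlDl => /(_ gi); rewrite -/K /= ?mulr0n ?mulr1n; lra.
    move=> s'j; have {}s'j : s' j = 0 by apply/eqP; rewrite eq_le s'j s'0.
    have -> : (L * s i + g i - (L * s' j + g' j)) *
        (mu * s i + g i - (mu * s' j + g' j)) = (g i - g' j) ^+ 2.
      by rewrite si s'j; ring.
    have [->|_] := eqVneq i i0; rewrite /= ?mulr0n ?mulr1n.
      have : t0 ^+ 2 <= (g i0 - g' j) ^+ 2.
        have h : t0 <= g i0 - g' j by have := g'le j; rewrite /t0; lra.
        by rewrite ler_pXn2r // nnegrE; lra.
      lra.
    have := sqr_ge0 (g i - g' j); lra.
  have -> : (i == i0) = false.
    by apply/negbTE; apply: contraTneq gi0 => <-; rewrite gl // ltxx.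
  rewrite gl //; have [s'j|] := ltP 0 (s' j); rewrite /= ?mulr0n ?mulr1n.
    rewrite (g'l j) //.
    have -> : (L * s i + lambda - (L * s' j + lambda)) *
       (mu * s i + lambda - (mu * s' j + lambda)) =
       L * mu * (s i - s' j) ^+ 2 by ring.
    have : 0 <= L * mu * (s i - s' j) ^+ 2.
      by rewrite mulr_ge0 ?sqr_ge0 // ltW // mulr_gt0.
    lra.
  move=> s'j; have {}s'j : s' j = 0 by apply/eqP; rewrite eq_le s'j s'0.
  have bsi := bs i si; have gj := g'le j.
  have h1 : L * b <= L * s i by rewrite ler_pM2l.
  have h2 : mu * b <= mu * s i by rewrite ler_pM2l.
  have : (L * b) * (mu * b) <=
      (L * s i + lambda - (L * s' j + g' j)) *
      (mu * s i + lambda - (mu * s' j + g' j)).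
    have Lb := mulr_gt0 L0 b0; have mb := mulr_gt0 mu0 b0.
    by apply: ler_pM; rewrite ?s'j; lra.
  lra.
pose w := \sum_i \sum_j T i j * (x i * y j).
have sx : \sum_i x i = r%:R.
  by rewrite -cr -sum1_card natr_sum [RHS]big_mkcond; apply: eq_bigr => i _;
    rewrite /x inE; case: ifP.
have sy : \sum_j y j = rs%:R.
  by rewrite -crs -sum1_card natr_sum [RHS]big_mkcond; apply: eq_bigr => j _;
    rewrite /y inE; case: ifP.
have wx : \sum_i \sum_j T i j * x i = r%:R.
  by rewrite -sx; apply: eq_bigr => i _; rewrite -mulr_suml rT mul1r.
have wy : \sum_i \sum_j T i j * y j = rs%:R.
  by rewrite exchange_big -sy; apply: eq_bigr => i _; rewrite -mulr_suml cT mul1r.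
have w1 : \sum_i \sum_j T i j = m%:R.
  by rewrite (eq_bigr _ (fun i _ => rT i)) sumr_const card_ord.
have x01 i : 0 <= x i <= 1 by rewrite /x; case: ltP => _; rewrite ler01 lexx.
have y01 j : 0 <= y j <= 1 by rewrite /y; case: ltP => _; rewrite ler01 lexx.
have th0 : 0 <= rs%:R - w.
  rewrite -wy /w -sumrB; apply: sumr_ge0 => i _; rewrite -sumrB.
  apply: sumr_ge0 => j _.
  rewrite -mulrBr mulr_ge0 // -{1}[y j]mul1r -mulrBl mulr_ge0 //.
  by have := x01 i; lra.
have wge0 : 0 <= w.
  apply: sumr_ge0 => i _; apply: sumr_ge0 => j _.
  by rewrite mulr_ge0 // mulr_ge0.
have wrr : r%:R + rs%:R - m%:R <= w.
  rewrite -subr_ge0.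
  have -> : w - (r%:R + rs%:R - m%:R) =
      \sum_i \sum_j T i j * ((1 - x i) * (1 - y j)).
    rewrite -w1 -wx -wy /w -!(sumrB, big_split) /=; apply: eq_bigr => i _.
    rewrite -!(sumrB, big_split) /=; apply: eq_bigr => j _; ring.
  apply: sumr_ge0 => i _; apply: sumr_ge0 => j _; rewrite mulr_ge0 // mulr_ge0 //.
    by have := x01 i; lra.
  by have := y01 j; lra.
have rm : (r <= m)%N by rewrite -cr -[X in (_ <= X)%N]card_ord max_card.
have rsm : (rs <= m)%N by rewrite -crs -[X in (_ <= X)%N]card_ord max_card.
have the : rs%:R - w <= (minn rs (m - r))%:R.
  by rewrite /minn; case: ltnP => _; rewrite ?natrB //; lra.
have de : (minn r (m - rs))%:R - (minn rs (m - r))%:R = r%:R - rs%:R :> R.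
  have /(congr1 (fun k => k%:R : R)) := minn_sub_swap rm rsm.
  rewrite !natrD; move: (_%:R) (_%:R) => p q; clear; lra.
have led : ((minn rs (m - r))%:R : R) <= (minn r (m - rs))%:R.
  by rewrite -subr_ge0 de subr_ge0 ler_nat.
have [f0 f0'] := @weight_tradeoff K _ _ (rs%:R - w)
  (introT andP (conj th0 the)) led cond.
rewrite de in f0 f0'.
(* v is the mass of the row i0 on the support of s'; it is part of the mass of
   the block where only s' is positive. *)
pose v := \sum_j T i0 j * y j.
have vth : v <= rs%:R - w.
  have x0 : x i0 = 0.
    by rewrite /x; case: ltP => // si0; move: gi0; rewrite gl // ltxx.
  have -> : rs%:R - w = \sum_i \sum_j T i j * ((1 - x i) * y j).
    rewrite -wy /w -sumrB; apply: eq_bigr => i _; rewrite -sumrB.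
    by apply: eq_bigr => j _; ring.
  rewrite (bigD1 i0) //=.
  have -> : \sum_j T i0 j * ((1 - x i0) * y j) = v.
    by apply: eq_bigr => j _; rewrite x0 subr0 mul1r.
  rewrite lerDl; apply: sumr_ge0 => i _; apply: sumr_ge0 => j _.
  by rewrite mulr_ge0 // mulr_ge0 //; have := x01 i; lra.
have v1 : v <= 1.
  by rewrite -(rT i0); apply: ler_sum => j _; rewrite ler_piMr //; have := y01 j; lra.
suff : L * mu * b ^+ 2 * (r%:R - rs%:R + (1 - K) * (rs%:R - w)) + t0 ^+ 2 * (1 - v)
  <= \sum_i \sum_j T i j * ((L * s i + g i - (L * s' j + g' j)) *
                             (mu * s i + g i - (mu * s' j + g' j))).
  apply: lt_le_trans; have t2 : 0 < t0 ^+ 2 by rewrite exprn_gt0.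
  case: f0' => [fp|th00].
    by rewrite ltr_pwDl ?mulr_gt0 // mulr_ge0 ?subr_ge0 // ltW.
  by rewrite ltr_wpDl ?mulr_gt0 // ?mulr_ge0 // ?ltW // subr_gt0; lra.
have -> : L * mu * b ^+ 2 * (r%:R - rs%:R + (1 - K) * (rs%:R - w)) +
    t0 ^+ 2 * (1 - v) =
  \sum_i \sum_j T i j *
    (L * mu * b ^+ 2 * (x i * (1 - y j) - K * ((1 - x i) * y j)) +
    (i == i0)%:R * ((1 - y j) * t0 ^+ 2)).
  have -> : t0 ^+ 2 * (1 - v) =
      \sum_i \sum_j T i j * ((i == i0)%:R * ((1 - y j) * t0 ^+ 2)).
    rewrite [in RHS](bigD1 i0) //= [X in _ = _ + X]big1 ?addr0; last first.
      by move=> i /negbTE->; rewrite big1 // => j _; rewrite mul0r mulr0.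
    have -> : 1 - v = \sum_j T i0 j * (1 - y j).
      by rewrite /v -[X in X - _](rT i0) -sumrB; apply: eq_bigr => j _; ring.
    by rewrite mulr_sumr eqxx; apply: eq_bigr => j _; rewrite /=; ring.
  have -> : r%:R - rs%:R + (1 - K) * (rs%:R - w) = (r%:R - w) - K * (rs%:R - w).
    by ring.
  rewrite -wx -wy /w -!sumrB !(mulr_sumr, =^~ sumrB) -big_split /=.
  apply: eq_bigr => i _; rewrite -!sumrB !(mulr_sumr, =^~ sumrB) -big_split /=.
  by apply: eq_bigr => j _; ring.
by apply: ler_sum => i _; apply: ler_sum => j _; rewrite ler_wpM2l.
Qed.

(** A product of two overlaps is at most half the sum of their squares, and
    by Bessel these squares form substochastic matrices. *)
Lemma overlap_le m n (P P' : 'M[R]_m) (W W' : 'M[R]_(n, m)) :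
  P^T *m P = 1%:M -> W^T *m W = 1%:M ->
  P'^T *m P' = 1%:M -> W'^T *m W' = 1%:M ->
  exists T : 'I_m -> 'I_m -> R,
    [/\ forall i j,
          mdot (col i P) (col j P') * mdot (col i W) (col j W') <= T i j,
        forall i j, 0 <= T i j, forall i, \sum_j T i j = 1
      & forall j, \sum_i T i j = 1].
Proof.
move=> PP WW PP' WW'.
pose S i j :=
  (mdot (col i P) (col j P') ^+ 2 + mdot (col i W) (col j W') ^+ 2) / 2.
have S0 i j : 0 <= S i j by rewrite divr_ge0 // addr_ge0 // sqr_ge0.
have [||T [ST rT cT]] := @doubly_stochastic_completion m S S0.
- move=> i; rewrite -mulr_suml big_split /= ler_pdivrMr // mul1r.
  have flip p (Q Q' : 'M[R]_(p, m)) : Q^T *m Q = 1%:M -> Q'^T *m Q' = 1%:M ->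
      \sum_j mdot (col i Q) (col j Q') ^+ 2 <= 1.
    move=> QQ QQ'; under eq_bigr do rewrite mdotC.
    by have := bessel (col i Q) QQ'; rewrite col_orthonormal // eqxx.
  by have := flip _ _ _ PP PP'; have := flip _ _ _ WW WW'; lra.
- move=> j; rewrite -mulr_suml big_split /= ler_pdivrMr // mul1r.
  have := bessel (col j P') PP; have := bessel (col j W') WW.
  by rewrite !col_orthonormal // eqxx mulr1n; lra.
exists T; split => // i j; last exact: le_trans (S0 i j) (ST i j).
apply: le_trans (ST i j); rewrite /S; set a := mdot _ _; set b := mdot _ _.
by have := sqr_ge0 (a - b); rewrite !expr2; lra.
Qed.

End Misalignment.

(** * Sufficiency of the condition *)

Section Sufficiency.
Context {R : realType}.

Lemma frakS_taylor m n (lambda L mu : R) rs (h : 'M[R]_(m, n) -> R) :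
  frakS lambda L mu rs h ->
  forall X H, h X + mdot (gradient h X) H + mu / 2 * mdot H H <= h (X + H)
               <= h X + mdot (gradient h X) H + L / 2 * mdot H H.
Proof.
move=> [hC2 hb _] X H; apply/andP; split.
  apply: taylor_lower_mx => // Y K; rewrite -frobenius_normE.
  by have /andP[] := hb Y K.
apply: taylor_upper_mx => // Y K; rewrite -frobenius_normE.
by have /andP[] := hb Y K.
Qed.

Theorem factorizable_of_condition m n (lambda L mu : R) rs r
    (h : 'M[R]_(m, n) -> R) :
  (m <= n)%N -> (1 <= r <= m)%N -> 0 < lambda -> 0 < mu -> mu <= L ->
  (r = m \/ ((rs <= r)%N /\
     (L / mu - 1) ^+ 2 / 4 * (minn rs (m - r))%:R < (minn r (m - rs))%:R)) ->
  frakS lambda L mu rs h -> factorizable lambda h r.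
Proof.
move=> mn /andP[r0 rm] l0 mu0 muL cond hS U V sosp.
have taylor := frakS_taylor hS.
have [hC2 hb [Xs Xsmin rkXs]] := hS.
have hL X H : hessian h X H <= L * mdot H H.
  by rewrite -frobenius_normE; have /andP[] := hb X H.
have lN := lt0r_neq0 l0.
set X := U *m V^T; set Z := - gradient h X.
have [ZV ZU] : Z *m V = lambda *: U /\ Z^T *m U = lambda *: V.
  by apply/(stationary_gradient _ _ _ hC2); case: sosp.
have [P [W [s [g [PP WW XE ZE sg]]]]] := balanced_joint_svd mn l0 ZV ZU.
rewrite -/X in XE.
have s0 i : 0 <= s 0 i by case: (sg i).
have g0 i : 0 <= g 0 i by case: (sg i).
have gl i : 0 < s 0 i -> g 0 i = lambda by case: (sg i).
move=> Y; rewrite leNgt; apply/negP => YX.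
have [i0 gi0] : exists i0, lambda < g 0 i0.
  apply: contrapT => /forallNP gle.
  have {}gle i : g 0 i <= lambda by rewrite leNgt; apply/negP/gle.
  suff : regularized lambda h X + mu / 2 * mdot (Y - X) (Y - X) <=
         regularized lambda h Y.
    have h2 : 0 <= mu / 2 * mdot (Y - X) (Y - X).
      by rewrite mulr_ge0 ?mdot_ge0 // divr_ge0 // ltW.
    by move: YX; lra.
  apply: (@subgradient_minimizer _ _ _ _ _ _ (gradient h X)) => //.
  - move=> Y'; have /andP[+ _] := taylor X (Y' - X).
    by have -> : X + (Y' - X) = Y' by rewrite addrC subrK.
  - rewrite scaleNr -scalerN -/Z ZE.
    have -> : lambda^-1 *: (P *m diag_mx g *m W^T) =
              P *m diag_mx (lambda^-1 *: g) *m W^T.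
      by rewrite linearZ /= -scalemxAr -scalemxAl.
    apply: contraction_svd => // i; rewrite mxE; apply/andP; split.
      by rewrite mulr_ge0 // invr_ge0 ltW.
    by rewrite ler_pdivrMl // mulr1.
  - rewrite -/Z ZE XE mdot_svd_same // nuclear_norm_svd // mulr_sumr.
    apply: eq_bigr => i _; have [/gl->//|si] := ltP 0 (s 0 i).
    have -> : s 0 i = 0 by apply/eqP; rewrite eq_le si s0.
    by rewrite !mulr0.
have colP i : mdot (col i P) (col i P) = 1 by rewrite col_orthonormal // eqxx.
have colW i : mdot (col i W) (col i W) = 1 by rewrite col_orthonormal // eqxx.
have Zw i : Z *m col i W = g 0 i *: col i P by rewrite ZE svd_mul_col.
have rkU : \rank U = r.
  apply/eqP; rewrite eqn_leq rank_leq_col /= leqNgt; apply/negP => rU.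
  have := rank_deficient_optimality l0 hC2 sosp (colP i0) (colW i0) (Zw i0) rU.
  by rewrite leNgt gi0.
have cr : #|[pred i | 0 < s 0 i]| = r.
  rewrite -(rank_svd PP WW s0) -XE mxrankMfree //.
  rewrite /row_free mxrank_tr; apply/eqP.
  apply/eqP; rewrite eqn_leq rank_leq_col /= leqNgt; apply/negP.
  move=> /exists_kernel_vector[q q0 Vq].
  have Uq : U *m q = 0.
    by apply: (scalerI lN); rewrite scalemxAl -ZV -mulmxA Vq mulmx0 scaler0.
  have : row_free U^T by rewrite /row_free mxrank_tr rkU.
  move=> /row_freeP[B UB]; move/eqP: q0; apply.
  by rewrite -[q]mul1mx -trmx1 -UB trmx_mul trmxK -mulmxA Uq mulmx0.
have si0 : s 0 i0 = 0.
  apply/eqP; rewrite eq_le s0 andbT leNgt; apply/negP => /gl gi.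
  by move: gi0; rewrite gi ltxx.
have rltm : r <> m.
  move=> rmE; have : i0 \in [pred i | 0 < s 0 i].
    apply: (@subset_cardP _ _ predT); last exact: subset_predT.
    by rewrite cr rmE card_ord.
  by rewrite inE si0 ltxx.
case: cond => // -[rsr cond].
have bound i j : s 0 i = 0 -> 0 < s 0 j -> g 0 i <= lambda + L * s 0 j.
  move=> si sj; have ij : (j == i) = false.
    by apply/negbTE; apply: contraTneq sj => ->; rewrite si ltxx.
  apply: (@cross_direction_bound R m n r lambda L h U V (col j P) (col i P)
    (col j W) (col i W)) => //.
  - by rewrite col_orthonormal // ij.
  - by rewrite col_orthonormal // ij.
  - by rewrite -/X XE svd_mul_col.
  - by rewrite -/X XE svd_trmul_col.
  - by rewrite -/X -/Z Zw gl.
set Zs := - gradient h Xs.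
have [Zs1 ZsX] : contraction (lambda^-1 *: Zs) /\
    mdot Zs Xs = lambda * nuclear_norm Xs.
  have [H|+ ->] := minimizer_subgradient (G := gradient h Xs) (L := L)
    mn l0 _ Xsmin.
    by have /andP[] := taylor Xs H.
  by rewrite scaleNr -scalerN; split.
have [P' [W' [s' [g' [PP' WW' XsE ZsE sg']]]]] :=
  minimizer_joint_svd mn l0 Zs1 ZsX.
have s'0 i : 0 <= s' 0 i by case: (sg' i).
have g'0 i : 0 <= g' 0 i by case: (sg' i).
have g'l i : 0 < s' 0 i -> g' 0 i = lambda by case: (sg' i).
have g'le i : g' 0 i <= lambda.
  have := Zs1 (col i P') (col i W').
  rewrite mdotZl mdot_rank1 ZsE svd_mul_col // mdotZl !col_orthonormal //.
  rewrite eqxx /= mulr1n.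
  by rewrite mulr1 ler_pdivrMl //; lra.
have crs : #|[pred i | 0 < s' 0 i]| = rs.
  by rewrite -rkXs -(rank_svd PP' WW' s'0) -XsE.
have [T [TO T0 rT cT]] := overlap_le PP WW PP' WW'.
have := misalignment_sum_gt0 mu0 muL T0 rT cT s0 s'0 gl g'l g'le bound gi0 r0
  cr crs rsr cond.
rewrite ltNge => /negP; apply.
(* The singular values of k X + Z and k X' + Z', for k = mu and k = L. *)
pose a k := k *: s + g; pose a' k := k *: s' + g'.
have aE k : P *m diag_mx (a k) *m W^T = k *: X + Z.
  by rewrite XE ZE /a linearD linearZ /= mulmxDr mulmxDl -scalemxAr -scalemxAl.
have a'E k : P' *m diag_mx (a' k) *m W'^T = k *: Xs + Zs.
  by rewrite XsE ZsE /a' linearD linearZ /= mulmxDr mulmxDl -scalemxAr -scalemxAl.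
have a0 k i : 0 <= k -> 0 <= a k 0 i.
  by move=> k0; rewrite !mxE addr_ge0 // mulr_ge0.
have a'0 k i : 0 <= k -> 0 <= a' k 0 i.
  by move=> k0; rewrite !mxE addr_ge0 // mulr_ge0.
have := cocoercivity muL taylor (erefl (X - Xs))
  (erefl (gradient h X - gradient h Xs)).
have -> : gradient h X - gradient h Xs - mu *: (X - Xs) =
   - ((mu *: X + Z) - (mu *: Xs + Zs)).
  by rewrite /Z /Zs; apply/matrixP => i j; rewrite !mxE; ring.
have -> : L *: (X - Xs) - (gradient h X - gradient h Xs) =
   (L *: X + Z) - (L *: Xs + Zs).
  by rewrite /Z /Zs; apply/matrixP => i j; rewrite !mxE; ring.
rewrite -!aE -!a'E mdotNl oppr_ge0 mdotBl !mdotBr.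
rewrite (mdotC (P' *m diag_mx (a' mu) *m W'^T) (P *m _ *m _)).
rewrite !mdot_svd_same // !mdot_svd.
set cross1 := \sum_i \sum_j _; set cross2 := \sum_i \sum_j _ => co.
pose O i j := mdot (col i P) (col j P') * mdot (col i W) (col j W').
have sumT (F F' : 'I_m -> R) :
    \sum_i \sum_j T i j * (F i + F' j) = \sum_i F i + \sum_j F' j.
  under eq_bigr => i _ do under eq_bigr => j _ do rewrite mulrDr.
  under eq_bigr => i _ do rewrite big_split /= -mulr_suml rT mul1r.
  rewrite big_split /= exchange_big /=; congr (_ + _).
  by apply: eq_bigr => j _; rewrite -mulr_suml cT mul1r.
(* The singular values are nonnegative, so overlaps may be replaced by their
   upper bounds T before any sign is considered. *)
have crossT : cross1 + cross2 <=
    \sum_i \sum_j T i j * (a mu 0 i * a' L 0 j + a L 0 i * a' mu 0 j).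
  rewrite -big_split; apply: ler_sum => i _; rewrite -big_split /=.
  apply: ler_sum => j _; rewrite -mulrDl mulrC ler_wpM2r //.
  by apply: addr_ge0; apply: mulr_ge0; [apply: a0|apply: a'0|apply: a0|apply: a'0];
    apply: ltW => //; exact: lt_le_trans muL.
rewrite (_ : \sum_i \sum_j _ =
  (\sum_i a mu 0 i * a L 0 i + \sum_j a' mu 0 j * a' L 0 j) -
  \sum_i \sum_j T i j * (a mu 0 i * a' L 0 j + a L 0 i * a' mu 0 j)); first lra.
rewrite -sumT -sumrB; apply: eq_bigr => i _; rewrite -sumrB; apply: eq_bigr => j _.
by rewrite !mxE; ring.
Qed.

End Sufficiency.

(** * Quadratics with a rank-one correction *)

Section QuadraticModel.
Context {R : realType}.

Lemma derive_quadratic_expansion (V : normedModType R) (f : V -> R) (x H : V)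
    (l q : R) : (forall s : R, f (x + s *: H) = f x + s * l + s ^+ 2 * q) ->
  'D_H f x = l.
Proof.
move=> fE; have := derive_on_line f x H 0; rewrite scale0r addr0 => ->.
have -> : (fun s : R => f (x + s *: H)) = (fun s => f x + s * l + s ^+ 2 * q).
  by apply/funext.
apply: derive_val; apply: is_derive_eq.
by rewrite /GRing.scale /=; ring.
Qed.

Context (m n : nat) (S z B : 'M[R]_(m, n)) (L c : R).

(** The quadratic with Hessian L Id - c z z^T whose gradient at S is B. *)
Definition rank_one_quadratic (Y : 'M[R]_(m, n)) : R :=
  L / 2 * mdot (Y - S) (Y - S) - c / 2 * mdot z (Y - S) ^+ 2 + mdot B Y.
Let h := rank_one_quadratic.

Definition rank_one_quadratic_gradient (Y : 'M[R]_(m, n)) : 'M[R]_(m, n) :=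
  L *: (Y - S) - (c * mdot z (Y - S)) *: z + B.
Let G := rank_one_quadratic_gradient.

Lemma rank_one_quadraticD Y H :
  h (Y + H) = h Y + mdot (G Y) H + (L / 2 * mdot H H - c / 2 * mdot z H ^+ 2).
Proof.
rewrite /h /G /rank_one_quadratic /rank_one_quadratic_gradient.
rewrite -[Y + H - S]addrAC; move: (Y - S) => X.
by rewrite !(mdotDl, mdotDr, mdotNl, mdotZl) (mdotC H X); field.
Qed.

Lemma derive_rank_one_quadratic H : 'D_H h = fun Y => mdot (G Y) H.
Proof.
apply/funext => Y; apply: (@derive_quadratic_expansion _ _ _ _ _
  (L / 2 * mdot H H - c / 2 * mdot z H ^+ 2)) => s.
by rewrite rank_one_quadraticD !mdotZr !mdotZl; ring.
Qed.

Lemma derive2_rank_one_quadratic K H Y :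
  'D_K ('D_H h) Y = L * mdot K H - c * mdot z K * mdot z H.
Proof.
rewrite derive_rank_one_quadratic.
apply: (@derive_quadratic_expansion _ _ _ _ _ 0) => s.
rewrite /G /rank_one_quadratic_gradient [Y + _ - S]addrAC.
by rewrite !(mdotDl, mdotDr, mdotNl, mdotZl, mdotZr); ring.
Qed.

Lemma C2_rank_one_quadratic : C2 h.
Proof.
have dsub Y : differentiable (fun X : 'M[R]_(m, n) => X - S) Y.
  by apply: differentiableB.
split.
- move=> Y; rewrite /h /rank_one_quadratic; apply: differentiableD; last first.
    exact: differentiable_mdot.
  apply: differentiableB.
    by apply: differentiableM => //; exact: differentiable_mdot.
  apply: differentiableM => //.
  by apply: (@differentiableM _ _ (fun X : 'M[R]_(m, n) => mdot z (X - S))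
    (fun X => mdot z (X - S))); exact: differentiable_mdot.
- move=> H Y; rewrite derive_rank_one_quadratic.
  have -> : (fun X => mdot (G X) H) =
      (fun X => L * mdot (X - S) H - c * mdot z (X - S) * mdot z H + mdot B H).
    apply/funext => X; rewrite /G /rank_one_quadratic_gradient.
    by rewrite !(mdotDl, mdotNl, mdotZl).
  apply: differentiableD => //; apply: differentiableB.
    by apply: differentiableM => //; exact: differentiable_mdot.
  apply: differentiableM => //; apply: differentiableM => //.
  exact: differentiable_mdot.
- move=> H K; rewrite (_ : 'D_K ('D_H h) =
    cst (L * mdot K H - c * mdot z K * mdot z H)).
    exact: cst_continuous.
  by apply/funext => Y; exact: derive2_rank_one_quadratic.
Qed.

Lemma gradient_rank_one_quadratic Y : gradient h Y = G Y.
Proof.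
apply/matrixP => i j; rewrite mxE.
have /(congr1 (fun f => f Y)) -> := derive_rank_one_quadratic (delta_mx i j).
move: (G Y) => Q; rewrite mdotE (bigD1 i) //= (bigD1 j) //=.
rewrite mxE !eqxx mulr1 !big1 ?addr0 //.
  by move=> k ki; rewrite big1 // => l _; rewrite mxE (negbTE ki) mulr0.
by move=> l lj; rewrite mxE (negbTE lj) andbF mulr0.
Qed.

Lemma mxvec_mulmx_tr (X Y : 'M[R]_(m, n)) :
  mxvec X *m (mxvec Y)^T = (mdot X Y)%:M.
Proof.
rewrite [LHS]mx11_scalar; congr _%:M.
rewrite mdotE mxE pair_bigA /= (reindex _ (curry_mxvec_bij m n)) /=.
by apply: eq_bigr => -[i j] _; rewrite mxE !mxvecE.
Qed.

Lemma quadratic_rank_one_quadratic : quadratic h.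
Proof.
exists ((L / 2)%:M - (c / 2) *: ((mxvec z)^T *m mxvec z)),
  (B - L *: S + (c * mdot z S) *: z),
  (L / 2 * mdot S S - c / 2 * mdot z S ^+ 2) => X.
rewrite -[\tr _]/(mdot _ _).
have -> : (mxvec X *m ((L / 2)%:M - (c / 2) *: ((mxvec z)^T *m mxvec z)) *m
     (mxvec X)^T) 0 0 = L / 2 * mdot X X - c / 2 * mdot z X ^+ 2.
  rewrite mulmxBr mulmxBl mul_mx_scalar -scalemxAl -scalemxAr -scalemxAl.
  rewrite mulmxA -(mulmxA (_ *m _)) !mxvec_mulmx_tr -scalar_mxM.
  by rewrite !mxE eqxx !mulr1n (mdotC X z) expr2.
rewrite /h /rank_one_quadratic.
by rewrite !(mdotDl, mdotDr, mdotNl, mdotNr, mdotZl, mdotZr) (mdotC S X); field.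
Qed.

End QuadraticModel.

(** * The counterexample *)

Section Counterexample.
Context {R : realType}.

(** In blocks along the support of X, the direction
    (col_mx A1 A2, col_mx B1 B2) changes X by block_mx (A1 + B1^T) B2^T A2 0.
    The Hessian of h pays L (|A2|^2 + |B2|^2), which compensates the gradient
    because g has operator norm at most lambda + L, and the blocks A1, B1 see
    only lambda (|A1|^2 + |B1|^2 - 2 <A1, B1>) >= 0. *)
Lemma block_second_order_stationary r m n (lambda L : R)
    (h : 'M[R]_(r + m, r + n) -> R) (g : 'M[R]_(m, n)) :
  C2 h -> 0 < lambda -> 0 < L ->
  gradient h (block_mx 1%:M 0 0 0) = - block_mx lambda%:M 0 0 g ->
  contraction ((lambda + L)^-1 *: g) ->
  (forall (M : 'M[R]_r) A B, L * (mdot A A + mdot B B) <=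
     hessian h (block_mx 1%:M 0 0 0) (block_mx M B A 0)) ->
  second_order_stationary (factored lambda h (r := r))
    (col_mx 1%:M 0, col_mx 1%:M 0).
Proof.
move=> hC2 l0 L0 gradE g1 hessE.
have XE : col_mx 1%:M 0 *m (col_mx 1%:M 0)^T =
    block_mx 1%:M 0 0 0 :> 'M[R]_(r + m, r + n).
  by rewrite tr_col_mx trmx0 trmx1 mul_col_row !mulmx0 !mul0mx mulmx1.
split.
  apply/stationary_gradient => //; rewrite XE gradE opprK; split.
    rewrite mul_block_col !mulmx0 !mul0mx !addr0 mulmx1 scale_col_mx scaler0.
    by rewrite scalemx1.
  rewrite tr_block_mx tr_scalar_mx !trmx0 mul_block_col !mulmx0 !mul0mx !addr0.
  by rewrite mulmx1 scale_col_mx scaler0 scalemx1.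
move=> [A B]; rewrite -[A]vsubmxK -[B]vsubmxK.
set A1 := usubmx A; set A2 := dsubmx A; set B1 := usubmx B; set B2 := dsubmx B.
rewrite hessian_factored // XE gradE !tr_col_mx !mul_col_row trmx1 trmx0.
rewrite !mulmx1 !mul1mx !mulmx0 !mul0mx add_block_mx !(addr0, add0r).
have := hessE (A1 + B1^T) A2 B2^T; rewrite mdot_tr mdotNl.
rewrite mdot_block_mx !mdot0l !addr0 !mdot_col_mx.
have e1 : mdot lambda%:M (A1 *m B1^T) = lambda * mdot A1 B1.
  by rewrite -scalemx1 mdotZl mdotC mdot_mulr mul1mx trmxK.
have := contraction_mulmx A2 B2 g1; rewrite mdotZl ler_pdivrMl; last lra.
have := mdot_ge0 (A1 - B1); rewrite !(mdotBl, mdotBr) (mdotC B1 A1) e1.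
move: (hessian _ _ _) => Hs.
set aa := mdot A1 A1; set bb := mdot B1 B1; set ab := mdot A1 B1.
set gg := mdot g _; set a2 := mdot A2 A2; set b2 := mdot B2 B2 => h1 h2 h3.
have h4 := mulr_ge0 (ltW l0) h1.
by lra.
Qed.

Lemma sum_indicator_lt n k (a : R) : (k <= n)%N ->
  \sum_(i < n) (if (i < k)%N then a else 0) = k%:R * a.
Proof.
move=> kn; rewrite -big_mkcond /=.
by rewrite (big_ord_narrow kn) sumr_const card_ord mulr_natl.
Qed.

Lemma sum_indicator_ge n k (a : R) : (k <= n)%N ->
  \sum_(i < n) (if (k <= i)%N then a else 0) = (n - k)%:R * a.
Proof.
move=> kn; apply: (addrI (k%:R * a)); rewrite -{1}(sum_indicator_lt a kn).
rewrite -big_split /= -mulrDl -natrD subnKC //.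
rewrite (eq_bigr (fun=> a)) ?sumr_const ?card_ord ?mulr_natl // => i _.
by case: ltnP => _; rewrite ?addr0 ?add0r.
Qed.

(** The minimizer S keeps q of the r unit singular values of X and has k
    new ones equal to y.  The two alternatives in the hypothesis on c express
    that the Hessian maps X - S to the prescribed difference of gradients: either
    c <z, X - S> = 1 or z = 0. *)
Lemma counterexample r m n (lambda L mu y c : R) (q k rs : nat) :
  (m <= n)%N -> 0 < lambda -> 0 < mu -> mu <= L ->
  (q <= r)%N -> (0 < k <= m)%N -> (q + k)%N = rs -> 0 < y -> 0 <= c ->
  (c * (L * ((r - q)%:R + k%:R * (y * (y - 1)))) = 1 \/ (q = r /\ y = 1)) ->
  c * (L ^+ 2 * ((r - q)%:R + k%:R * (y - 1) ^+ 2)) <= L - mu ->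
  exists h : 'M[R]_(r + m, r + n) -> R,
    [/\ quadratic h, frakS lambda L mu rs h & ~ factorizable lambda h r].
Proof.
move=> mn l0 mu0 muL qr /andP[k0 km] qk y0 c0 cE cle.
have L0 : 0 < L by lra.
pose W2 : 'M[R]_(n, m) := pid_mx m.
have W21 : W2^T *m W2 = 1%:M.
  by rewrite tr_pid_mx mul_pid_mx minnn (minn_idPr mn) pid_mx_1.
pose W : 'M[R]_(r + n, r + m) := block_mx 1%:M 0 0 W2.
have W1 : W^T *m W = 1%:M.
  rewrite tr_block_mx mulmx_block !trmx0 !(mulmx0, mul0mx, addr0, add0r) W21.
  by rewrite trmx1 mulmx1 -scalar_mx_block.
(* Rectangular diagonal matrices, written as singular value decompositions
   whose left factor is the identity. *)
pose D (a : 'rV[R]_r) (b : 'rV[R]_m) := diag_mx (row_mx a b) *m W^T.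
have DE a b : D a b = 1%:M *m diag_mx (row_mx a b) *m W^T by rewrite mul1mx.
have Dblock a b : D a b = block_mx (diag_mx a) 0 0 (diag_mx b *m W2^T).
  rewrite /D diag_mx_row tr_block_mx mulmx_block !trmx0.
  by rewrite !(mulmx0, mul0mx, addr0, add0r) trmx1 mulmx1.
have DD a b a' b' : D a b + D a' b' = D (a + a') (b + b').
  by rewrite /D -mulmxDl -linearD add_row_mx.
have DZ t a b : t *: D a b = D (t *: a) (t *: b).
  by rewrite /D scalemxAl -linearZ /= scale_row_mx.
have DN a b : - D a b = D (- a) (- b) by rewrite -scaleN1r DZ !scaleN1r.
have T1 : (1%:M : 'M[R]_(r + m))^T *m 1%:M = 1%:M by rewrite trmx1 mulmx1.
have dotD a b a' b' : mdot (D a b) (D a' b') =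
    \sum_i a 0 i * a' 0 i + \sum_i b 0 i * b' 0 i.
  rewrite !DE mdot_svd_same // big_split_ord /=; congr (_ + _).
    by apply: eq_bigr => i _; rewrite !row_mxEl.
  by apply: eq_bigr => i _; rewrite !row_mxEr.
pose dr (P : nat -> bool) (a : R) p : 'rV[R]_p :=
  \row_(i < p) (if P i then a else 0).
pose lo := fun i => (i < q)%N; pose hi := fun i => (q <= i)%N.
pose ks := fun i => (i < k)%N.
pose S := D (dr lo 1 r) (dr ks y m).
pose X := D (const_mx 1) 0.
pose z := D (dr hi L r) (dr ks (- (L * (y - 1))) m).
pose B := D (const_mx (- lambda)) (const_mx (- lambda)).
pose h := rank_one_quadratic S z B L c.
have XS : X - S = D (dr hi 1 r) (dr ks (- y) m).
  rewrite DN DD; congr D; apply/rowP => i; rewrite !mxE /lo /hi /ks.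
    by case: ltnP => _; ring.
  by case: ltnP => _; ring.
have zXS : mdot z (X - S) = L * ((r - q)%:R + k%:R * (y * (y - 1))).
  rewrite XS dotD.
  rewrite (eq_bigr (fun i : 'I_r => if (q <= i)%N then L else 0)); last first.
    by move=> i _; rewrite !mxE /hi; case: ifP => _; ring.
  rewrite [X in _ + X](eq_bigr
    (fun i : 'I_m => if (i < k)%N then L * (y * (y - 1)) else 0)); last first.
    by move=> i _; rewrite !mxE /ks; case: ifP => _; ring.
  by rewrite sum_indicator_ge // sum_indicator_lt //; ring.
have zz : mdot z z = L ^+ 2 * ((r - q)%:R + k%:R * (y - 1) ^+ 2).
  rewrite dotD.
  rewrite (eq_bigr (fun i : 'I_r => if (q <= i)%N then L ^+ 2 else 0)); last first.
    by move=> i _; rewrite !mxE /hi; case: ifP => _; ring.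
  rewrite [X in _ + X](eq_bigr
    (fun i : 'I_m => if (i < k)%N then L ^+ 2 * (y - 1) ^+ 2 else 0)); last first.
    by move=> i _; rewrite !mxE /ks; case: ifP => _; ring.
  by rewrite sum_indicator_ge // sum_indicator_lt //; ring.
(* The Hessian L Id - c z z^T is at least mu Id. *)
have czz H : c * mdot z H ^+ 2 <= (L - mu) * mdot H H.
  apply: le_trans (_ : c * (mdot z z * mdot H H) <= _).
    by rewrite ler_wpM2l // mdot_cauchy_schwarz.
  by rewrite mulrA ler_wpM2r ?mdot_ge0 // zz.
have hC2 : C2 h by exact: C2_rank_one_quadratic.
have hessE Y H : hessian h Y H = L * mdot H H - c * mdot z H ^+ 2.
  by rewrite /hessian derive2_rank_one_quadratic expr2 mulrA.
have gradX : gradient h X =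
    - D (const_mx lambda) (const_mx lambda + dr ks L m).
  rewrite gradient_rank_one_quadratic /rank_one_quadratic_gradient.
  have -> : (c * mdot z (X - S)) *: z = z.
    rewrite zXS; case: cE => [->|[qr' y1]]; first by rewrite scale1r.
    have -> : z = 0; last by rewrite scaler0.
    apply: mdot_eq0; rewrite zz qr' subnn y1 subrr expr0n mulr0 addr0 mulr0 //.
  rewrite XS /z /B DZ !DN !DD; congr D; apply/rowP => i.
    by rewrite !mxE; case: ifP => _; ring.
  by rewrite !mxE; case: ifP => _; ring.
have gradS : gradient h S = B.
  rewrite gradient_rank_one_quadratic /rank_one_quadratic_gradient.
  by rewrite subrr mdot0r mulr0 scaler0 scale0r subr0 add0r.
have S0 i : 0 <= (row_mx (dr lo 1 r) (dr ks y m)) 0 i.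
  case: (split_ordP i) => j ->; rewrite (row_mxEl, row_mxEr) mxE;
    by case: ifP => _ //; exact: ltW.
have Smin Y : regularized lambda h S + mu / 2 * mdot (Y - S) (Y - S) <=
    regularized lambda h Y.
  apply: (@subgradient_minimizer _ _ _ _ _ _ B) => //; first by rewrite leq_add2l.
  - move=> Y'; have -> : h Y' = h (S + (Y' - S)) by rewrite addrC subrK.
    rewrite {2}/h rank_one_quadraticD -gradient_rank_one_quadratic -/h gradS.
    by have := czz (Y' - S); rewrite -/h; lra.
  - rewrite DZ DE; apply: contraction_svd => // i.
    case: (split_ordP i) => j ->; rewrite (row_mxEl, row_mxEr) !mxE;
      by rewrite mulNr mulrN opprK mulVf ?lt0r_neq0 // ler01 lexx.
  - rewrite /B /S DN !DE mdot_svd_same // nuclear_norm_svd // mulr_sumr.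
    apply: eq_bigr => i _; congr (_ * _).
    case: (split_ordP i) => j ->; rewrite (row_mxEl, row_mxEr) !mxE;
      by rewrite opprK.
have XSN : 0 < mdot (X - S) (X - S).
  rewrite XS dotD ltr_wpDl //.
    by apply: sumr_ge0 => i _; rewrite -expr2 sqr_ge0.
  have km' : (0 < m)%N by exact: leq_trans k0 km.
  rewrite (bigD1 (Ordinal km')) //= ltr_pwDl //.
    by rewrite !mxE /ks k0 mulrNN mulr_gt0.
  by apply: sumr_ge0 => i _; rewrite -expr2 sqr_ge0.
exists h; split.
- exact: quadratic_rank_one_quadratic.
- split => //.
    move=> Y H; rewrite hessE frobenius_normE; apply/andP; split.
      by have := czz H; lra.
    by rewrite lerBlDr lerDl mulr_ge0 ?sqr_ge0.
  exists S.
    move=> Y; apply: le_trans (Smin Y); rewrite lerDl mulr_ge0 ?mdot_ge0 //.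
    by rewrite divr_ge0 // ltW.
  rewrite /S DE rank_svd // -sum1_card big_mkcond big_split_ord /= -qk.
  have count p (P : nat -> bool) (a : R) (F : 'I_p -> 'I_(r + m))
      (w : 'rV[R]_(r + m)) :
      0 < a -> (forall i, w 0 (F i) = dr P a p 0 i) ->
      (\sum_(i < p) (if F i \in [pred j | (0 < w 0 j)%R] then 1 else 0) =
       \sum_(i < p) P i)%N.
    move=> a0 wF; apply: eq_bigr => i _; rewrite inE wF mxE.
    by case: (P i); rewrite ?a0 ?ltxx.
  have cnt p l : (l <= p)%N -> (\sum_(i < p) (i < l) = l)%N.
    move=> lp; rewrite -[RHS]card_ord -sum1_card (big_ord_widen _ (fun=> 1%N) lp).
    by rewrite [RHS]big_mkcond; apply: eq_bigr => i _; case: (_ < _)%N.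
  congr (_ + _)%N.
    rewrite (count _ lo 1) ?cnt // => i; exact: row_mxEl.
  rewrite (count _ ks y) ?cnt // => i; exact: row_mxEr.
have XE : X = block_mx 1%:M 0 0 0.
  by rewrite /X Dblock diag_const_mx raddf0 mul0mx.
have sosp : second_order_stationary (factored lambda h (r := r))
    (col_mx 1%:M 0, col_mx 1%:M 0).
  apply: (@block_second_order_stationary _ _ _ _ L _
    (diag_mx (const_mx lambda + dr ks L m) *m W2^T)) => //.
  - by rewrite -XE gradX Dblock diag_const_mx.
  - rewrite scalemxAl -linearZ /= -[diag_mx _]mul1mx.
    apply: contraction_svd => //; first by rewrite trmx1 mulmx1.
    have lL : 0 < lambda + L by lra.
    move=> i; rewrite !mxE; apply/andP; split.
      by rewrite mulr_ge0 // ?invr_ge0; [exact: ltW|case: ifP => _; lra].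
    by rewrite ler_pdivrMl // mulr1; case: ifP => _; lra.
  - move=> M A' B'; rewrite hessE.
    have -> : block_mx M B' A' 0 = block_mx M 0 0 0 + block_mx 0 B' A' 0.
      by rewrite add_block_mx !(addr0, add0r).
    have -> : mdot z (block_mx M 0 0 0 + block_mx 0 B' A' 0) =
        mdot z (block_mx M 0 0 0).
      rewrite mdotDr -[RHS]addr0; congr (_ + _).
      by rewrite /z Dblock mdot_block_mx !(mdot0l, mdot0r, addr0).
    have := czz (block_mx M 0 0 0).
    rewrite add_block_mx !(addr0, add0r) !mdot_block_mx.
    rewrite !(mdot0l, mdot0r, addr0, add0r).
    by have := mulr_ge0 (ltW mu0) (mdot_ge0 M); lra.
move=> /(_ _ _ sosp S).
rewrite tr_col_mx trmx0 trmx1 mul_col_row !mulmx0 !mul0mx mulmx1 -XE.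
move=> XleS; have := le_trans (Smin X) XleS; rewrite gerDl leNgt.
by rewrite mulr_gt0 // divr_gt0.
Qed.

(** The bound on c is equivalent, after clearing denominators, to
    p <= k (y - 1) (kappa - y), whose right-hand side is largest at
    y = (kappa + 1) / 2. *)
Lemma counterexample_weights (p k : nat) (L mu : R) :
  0 < mu -> mu <= L -> (0 < p)%N -> (0 < k)%N ->
  p%:R <= (L / mu - 1) ^+ 2 / 4 * k%:R ->
  let y := (L / mu + 1) / 2 in
  let c := (L * (p%:R + k%:R * (y * (y - 1))))^-1 in
  [/\ 0 < y, 0 <= c, c * (L * (p%:R + k%:R * (y * (y - 1)))) = 1
    & c * (L ^+ 2 * (p%:R + k%:R * (y - 1) ^+ 2)) <= L - mu].
Proof.
move=> mu0 muL p0 k0 pk y c.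
have L0 : 0 < L by exact: lt_le_trans muL.
have [t tE] : exists t, t = L / mu by eexists.
have t1 : 1 <= t by rewrite tE ler_pdivlMr // mul1r.
have LE : L = t * mu by rewrite tE divfK ?gt_eqF.
have yE : y = (t + 1) / 2 by rewrite /y -tE.
have y1 : 1 <= y by rewrite yE; lra.
have pR : 0 < p%:R :> R by rewrite ltr0n.
have kR : 0 < k%:R :> R by rewrite ltr0n.
have s0 : 0 < p%:R + k%:R * (y * (y - 1)).
  by rewrite ltr_pwDl // !mulr_ge0 //; lra.
have Ls0 : 0 < L * (p%:R + k%:R * (y * (y - 1))) by rewrite mulr_gt0.
split.
- lra.
- by rewrite invr_ge0 ltW.
- by rewrite mulVf // gt_eqF.
rewrite ler_pdivrMl // -subr_ge0.
rewrite -tE in pk.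
have -> : L * (p%:R + k%:R * (y * (y - 1))) * (L - mu) -
    L ^+ 2 * (p%:R + k%:R * (y - 1) ^+ 2) =
    L * mu * ((t - 1) ^+ 2 / 4 * k%:R - p%:R).
  by rewrite yE LE; field.
by rewrite mulr_ge0 ?subr_ge0 // mulr_ge0 // ltW.
Qed.

End Counterexample.

(** * The dichotomy *)

Theorem theorem1p3 (R : realType) (m n : nat) (lambda : R) (rs r : nat)
    (L mu : R)
    (hm : (1 <= m)%N) (hmn : (m <= n)%N) (hlambda : 0 < lambda)
    (hrs : (rs <= m)%N) (hr : (1 <= r <= m)%N)
    (hmu : 0 < mu) (hmuL : mu <= L) :
  let kappa := L / mu in
  let condition :=
    r = m \/
    ((rs <= r)%N /\
     (kappa - 1) ^+ 2 / 4 * (minn rs (m - r))%:R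
       < (minn r (m - rs))%:R) in
  (condition ->
     forall h : 'M[R]_(m, n) -> R,
       frakS lambda L mu rs h -> factorizable lambda h r) /\
  (~ condition ->
     exists h : 'M[R]_(m, n) -> R,
       [/\ quadratic h, frakS lambda L mu rs h & ~ factorizable lambda h r]).
Proof.
move=> kappa condition; split=> [cond h hS|ncond].
  exact: factorizable_of_condition cond hS.
have /andP[r0 rm] := hr.
have rNm : r <> m by move=> rm'; apply: ncond; left.
have rltm : (r < m)%N by rewrite ltn_neqAle rm andbT; apply/eqP.
have [k [q [y [c [[qr k0 km qk] y0 c0 cE cle]]]]] :
    exists (k q : nat) (y c : R), [/\ [/\ (q <= r)%N, (0 < k)%N, (k <= m - r)%N
      & (q + k)%N = rs], 0 < y, 0 <= c,
      (c * (L * ((r - q)%:R + k%:R * (y * (y - 1)))) = 1 \/ (q = r /\ y = 1))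
    & c * (L ^+ 2 * ((r - q)%:R + k%:R * (y - 1) ^+ 2)) <= L - mu].
  have [rsr|rrs] := leqP rs r; last first.
    (* Rank r is too small: h is L / 2 times a squared distance. *)
    exists (rs - r)%N, r, 1, 0; split => //; first by split; lia.
      by right.
    by rewrite mul0r subr_ge0.
  have Kk : (minn r (m - rs))%:R <= (L / mu - 1) ^+ 2 / 4 * (minn rs (m - r))%:R.
    by rewrite leNgt; apply/negP => h; apply: ncond; right.
  have p0 : (0 < minn r (m - rs))%N by lia.
  have k0 : (0 < minn rs (m - r))%N.
    rewrite lt0n; apply: contraTneq Kk => ->; rewrite mulr0 -ltNge ltr0n.
    exact: p0.
  have [y0 c0 cE cle] := @counterexample_weights R _ _ L mu hmu hmuL p0 k0 Kk.
  have pE : (r - (rs - minn rs (m - r)))%N = minn r (m - rs) by lia.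
  eexists (minn rs (m - r)), (rs - minn rs (m - r))%N, _, _.
  split; [|exact: y0|exact: c0|left|]; rewrite ?pE //.
  by split => //; lia.
have := @counterexample R r (m - r) (n - r) lambda L mu y c q k rs.
rewrite (subnKC rm) (subnKC (leq_trans rm hmn)); apply => //.
  by rewrite leq_sub2r.
by rewrite k0 km.
Qed.
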